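(* Let $\alpha\in\mathbb{R}\setminus\mathbb{Q}$ with $0<\beta(\alpha)<\infty$, let $\eta>C_1\beta(\alpha)$, let $f$ be real analytic on $\mathbb{R}/\mathbb{Z}$ and analytic on the strip $\{z\in\mathbb{C}/\mathbb{Z}:|\Im z|\le C_2\eta\}$, and let $0<|\lambda|\le\lambda_0$, where $C_1,C_2$ and $\lambda_0=\lambda_0(f,\eta,\alpha)$ are as in the context. For $m\in\mathbb{Z}\setminus\{0\}$ let $G_m=(E_m^-,E_m^+)$ (with $G_m=\{E_m^-\}$ if $E_m^-=E_m^+$), and let $G_0=(-\infty,E_{\min})\cup(E_{\max},+\infty)$. Then there is a constant $c_\star>0$ depending only on $\lambda,f,\alpha$ such that for all $m,m'\in\mathbb{Z}\setminus\{0\}$ with $m'\ne m$ and $|m'|\ge|m|$, $$\mathrm{dist}(G_m,G_{m'})=\inf_{x\in G_m,\,x'\in G_{m'}}|x-x'|\ge c_\star e^{-8\beta(\alpha)|m'|},$$ and for all $m\in\mathbb{Z}\setminus\{0\}$, $$\mathrm{dist}(G_m,G_0)\ge c_\star e^{-8\beta(\alpha)|m|}.$$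
   Context: $(H_{\lambda f,\alpha,\theta}x)_n=x_{n+1}+x_{n-1}+\lambda f(\theta+n\alpha)x_n$ on $\ell^2(\mathbb{Z})$, with $\theta$-independent spectrum $\Sigma_{\lambda f,\alpha}$; $E_{\min}=\min\Sigma_{\lambda f,\alpha}$, $E_{\max}=\max\Sigma_{\lambda f,\alpha}$. $\beta(\alpha)=\limsup_{k\to\infty}\frac{-\ln\|k\alpha\|_{\mathbb{R}/\mathbb{Z}}}{|k|}$, $\|x\|_{\mathbb{R}/\mathbb{Z}}=\min_{k\in\mathbb{Z}}|x-k|$. With $S_{\lambda f,E}(x)=\begin{pmatrix}E-\lambda f(x)&-1\\1&0\end{pmatrix}$, $\rho_{\lambda f,\alpha}(E)\in[0,\frac12]$ is the fibered rotation number of the cocycle $(\alpha,S_{\lambda f,E})$, i.e. the average rotation (in units of $2\pi$) of directions under iteration of $(x,v)\mapsto(x+\alpha,S_{\lambda f,E}(x)v)$, normalized to be continuous and non-increasing in $E$ from $\frac12$ (for $E\le E_{\min}$) to $0$ (for $E\ge E_{\max}$); equivalently $1-2\rho_{\lambda f,\alpha}$ is the integrated density of states. For $m\ne0$, $[E_m^-,E_m^+]=\{E:2\rho_{\lambda f,\alpha}(E)=m\alpha\bmod\mathbb{Z}\}$. $C_1,C_2$ are fixed sufficiently large absolute constants and $\lambda_0=\lambda_0(f,\eta,\alpha)>0$ is a threshold for which the following known result (Liu–Yuan) holds: if $0<|\lambda|\le\lambda_0$, then $|\rho_{\lambda f,\alpha}(E_1)-\rho_{\lambda f,\alpha}(E_2)|\le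 C_\star|E_1-E_2|^{1/2}$ for all $E_1,E_2\in\mathbb{R}$, with $C_\star$ depending only on $\lambda,f,\alpha$. *)

(* Defs.v *)
From Stdlib Require Export Reals ZArith.
From Coquelicot Require Export Coquelicot.

Open Scope R_scope.

Definition irrational (x : R) : Prop :=
  forall p q : Z, q <> 0%Z -> x <> IZR p / IZR q.

Definition norm_RZ (x : R) : R :=
  real (Glb_Rbar (fun d => exists k : Z, d = Rabs (x - IZR k))).

(* [k] ranges over the naturals: the quotient is even in [k].  The junk value at
   [k = 0] does not affect the upper limit. *)
Definition beta (alpha : R) : Rbar :=
  LimSup_seq (fun k : nat => - ln (norm_RZ (INR k * alpha)) / INR k).

Definition analytic_at {K : AbsRing} (F : K -> K) (z : K) : Prop :=
  exists (r : posreal) (a : nat -> AbsRing_NormedModule K),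
    forall w : K, abs (minus w z) < r -> is_pseries a (minus w z) (F w).

(* Functions on R/Z and C/Z are 1-periodic functions on R and C. *)
Definition real_analytic_circle (f : R -> R) : Prop :=
  (forall x : R, f (x + 1) = f x) /\
  (forall x : R, analytic_at (K := R_AbsRing) f x).

(* Analytic on the closed strip: a convergent power series expansion at every
   point of it, hence analytic on a neighbourhood of it. *)
Definition analytic_on_strip (f : R -> R) (h : R) : Prop :=
  exists F : C -> C,
    (forall z : C, F (Cplus z (RtoC 1)) = F z) /\
    (forall x : R, F (RtoC x) = RtoC (f x)) /\
    (forall z : C, Rabs (Im z) <= h -> analytic_at (K := C_AbsRing) F z).

Definition seqZ : Type := Z -> C.

Definition in_ell2 (u : seqZ) : Prop :=
  ex_series (fun n : nat => Cmod (u (Z.of_nat n)) ^ 2) /\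
  ex_series (fun n : nat => Cmod (u (- Z.of_nat (S n))%Z) ^ 2).

Definition ell2_norm (u : seqZ) : R :=
  sqrt (Series (fun n : nat => Cmod (u (Z.of_nat n)) ^ 2) +
        Series (fun n : nat => Cmod (u (- Z.of_nat (S n))%Z) ^ 2)).

Definition bounded_operator (B : seqZ -> seqZ) : Prop :=
  (forall (a b : C) (u v : seqZ), in_ell2 u -> in_ell2 v -> forall n : Z,
     B (fun k => Cplus (Cmult a (u k)) (Cmult b (v k))) n =
     Cplus (Cmult a (B u n)) (Cmult b (B v n))) /\
  (exists M : R, forall u : seqZ, in_ell2 u ->
     in_ell2 (B u) /\ ell2_norm (B u) <= M * ell2_norm u).

Definition resolvent_set (T : seqZ -> seqZ) (z : C) : Prop :=
  let Tz := fun u n => Cminus (T u n) (Cmult z (u n)) in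
  exists B : seqZ -> seqZ, bounded_operator B /\
    forall u : seqZ, in_ell2 u ->
      (forall n : Z, B (Tz u) n = u n) /\ (forall n : Z, Tz (B u) n = u n).

Definition spectrum (T : seqZ -> seqZ) (z : C) : Prop := ~ resolvent_set T z.

Definition schrodinger (lambda : R) (f : R -> R) (alpha theta : R) (u : seqZ) : seqZ :=
  fun n => Cplus (Cplus (u (n + 1)%Z) (u (n - 1)%Z))
                 (Cmult (RtoC (lambda * f (theta + IZR n * alpha))) (u n)).

(* For irrational [alpha] and continuous [f] the spectrum does not depend on
   [theta], so the union over [theta] is the common value; it is real because
   the operators are self-adjoint. *)
Definition Sigma (lambda : R) (f : R -> R) (alpha : R) (E : R) : Prop :=
  exists theta : R, spectrum (schrodinger lambda f alpha theta) (RtoC E).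

(* [Sigma] is compact and nonempty, so these are its minimum and maximum. *)
Definition E_min (lambda : R) (f : R -> R) (alpha : R) : Rbar :=
  Glb_Rbar (Sigma lambda f alpha).
Definition E_max (lambda : R) (f : R -> R) (alpha : R) : Rbar :=
  Lub_Rbar (Sigma lambda f alpha).

Record mat2 : Type := Mat2 { m11 : R; m12 : R; m21 : R; m22 : R }.

Definition mat2_act (A : mat2) (v : R * R) : R * R :=
  (m11 A * fst v + m12 A * snd v, m21 A * fst v + m22 A * snd v).

(* The unit vector whose argument is [y] in units of 2 PI. *)
Definition direction (y : R) : R * R := (cos (2 * PI * y), sin (2 * PI * y)).

(* [(x, y) |-> (x + alpha, y + psi x y)] is a continuous lift of the action of
   the cocycle [(alpha, A)] on (R/Z) x (circle of directions).  When it exists,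
   [psi] is unique up to an additive integer. *)
Definition cocycle_lift (A : R -> mat2) (psi : R -> R -> R) : Prop :=
  (forall x y : R, continuity_2d_pt psi x y) /\
  (forall x y : R, psi (x + 1) y = psi x y /\ psi x (y + 1) = psi x y) /\
  (forall x y : R, exists r : R, 0 < r /\
     mat2_act (A x) (direction y) =
     (r * fst (direction (y + psi x y)), r * snd (direction (y + psi x y)))).

Definition lifted_map (alpha : R) (psi : R -> R -> R) (p : R * R) : R * R :=
  (fst p + alpha, snd p + psi (fst p) (snd p)).

(* The real [r] represents the fibered rotation number, an element of R/Z; the
   integer ambiguity is that of the lift. *)
Definition is_fibered_rotation_number (alpha : R) (A : R -> mat2) (r : R) : Prop :=
  exists psi : R -> R -> R, cocycle_lift A psi /\
    forall x y : R,
      is_lim_seq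
        (fun n : nat => (snd (Nat.iter n (lifted_map alpha psi) (x, y)) - y) / INR n) r.

Definition S_cocycle (lambda : R) (f : R -> R) (E : R) (x : R) : mat2 :=
  Mat2 (E - lambda * f x) (-1) 1 0.

(* The representative in [0, 1/2]; it is unique, and it is the one that decreases
   from 1/2 (below the spectrum) to 0 (above it). *)
Definition rho (lambda : R) (f : R -> R) (alpha E : R) : R :=
  iota (fun r : R => 0 <= r <= 1 / 2 /\
          is_fibered_rotation_number alpha (S_cocycle lambda f E) r).

Definition has_label (lambda : R) (f : R -> R) (alpha : R) (m : Z) (E : R) : Prop :=
  exists k : Z, 2 * rho lambda f alpha E = IZR m * alpha + IZR k.

(* [Em m] and [Ep m] are the endpoints E_m^- and E_m^+. *)
Definition gap_endpoints (lambda : R) (f : R -> R) (alpha : R) (Em Ep : Z -> R) : Prop :=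
  forall m : Z, m <> 0%Z ->
    forall E : R, Em m <= E <= Ep m <-> has_label lambda f alpha m E.

Definition gap (a b : R) (E : R) : Prop := a < E < b \/ (a = b /\ E = a).

Definition gap0 (lambda : R) (f : R -> R) (alpha : R) (E : R) : Prop :=
  Rbar_lt E (E_min lambda f alpha) \/ Rbar_lt (E_max lambda f alpha) E.

Definition dist_sets (A B : R -> Prop) : Rbar :=
  Glb_Rbar (fun d => exists x x' : R, A x /\ B x' /\ d = Rabs (x - x')).

Definition admissible (C1 C2 : R) (f : R -> R) (eta alpha : R) : Prop :=
  irrational alpha /\
  Rbar_lt 0 (beta alpha) /\ Rbar_lt (beta alpha) p_infty /\
  eta > C1 * real (beta alpha) /\
  real_analytic_circle f /\ analytic_on_strip f (C2 * eta).

(* [C1], [C2] and the threshold [lambda0] are such that the Liu-Yuan theorem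
   (1/2-Hoelder continuity of the rotation number) holds.  The Hoelder constant
   depends on [lambda], [f] and [alpha] but not on [eta]. *)
Definition liu_yuan_constants (C1 C2 : R) (lambda0 : (R -> R) -> R -> R -> R) : Prop :=
  0 < C1 /\ 0 < C2 /\
  (forall (f : R -> R) (eta alpha : R),
     admissible C1 C2 f eta alpha -> 0 < lambda0 f eta alpha) /\
  (forall (lambda : R) (f : R -> R) (alpha : R),
     exists Cstar : R, forall eta : R,
       admissible C1 C2 f eta alpha ->
       0 < Rabs lambda <= lambda0 f eta alpha ->
       forall E1 E2 : R,
         Rabs (rho lambda f alpha E1 - rho lambda f alpha E2)
           <= Cstar * sqrt (Rabs (E1 - E2))).

(* Main.v *)
Require Import Defs.
From Stdlib Require Import Lra Lia Classical.
Open Scope R_scope.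

(** Energies in [G_m] and [G_m'] have [2 rho] equal to [m alpha] and [m' alpha] modulo [Z], so
    these values differ by at least [||(m - m') alpha|| >= c exp (- 2 beta |m - m'|)], and
    [|m - m'| <= 2 |m'|]; the 1/2-Hoelder bound turns this into a distance of energies, the
    square doubling the exponent to [8 beta |m'|].

    For [G_0] one needs [2 rho] to be an integer outside the convex hull of the spectrum.  The
    extremal values of the quadratic form of a bounded Jacobi operator lie in its spectrum, so
    for [E < E_min] (resp. [E > E_max]) the form of [H - E] is positive (resp. negative)
    definite.  Testing it on cut-offs of the Dirichlet solution, every consecutive pair
    of values of that solution has opposite (resp. equal) signs.  Its direction thus advances by
    a half turn per step (resp. stays in one quadrant) up to a bounded error, and monotonicity
    of the lifted map gives the same rotation number, 1/2 (resp. 0), for all directions. *)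

(** * Small divisors *)

(** The nearest integers to [x] are [up x - 1] and [up x], and neither equals [x]. *)
Lemma dist_to_integers_pos (x : R) :
  (forall l : Z, x <> IZR l) ->
  exists d : R, 0 < d /\ forall l : Z, d <= Rabs (x - IZR l).
Proof.
  intros Hx.
  destruct (archimed x) as [H1 H2].
  exists (Rmin (IZR (up x) - x) (x - IZR (up x - 1))); split.
  - apply Rmin_glb_lt; [lra|].
    pose proof (Hx (up x - 1)%Z) as H3.
    rewrite minus_IZR in *.
    lra.
  - intros l.
    destruct (Z_lt_le_dec l (up x)) as [Hl|Hl].
    + assert (Hl' : IZR l <= IZR (up x - 1)) by (apply IZR_le; lia).
      eapply Rle_trans; [apply Rmin_r|].
      eapply Rle_trans; [|apply Rle_abs].
      lra.
    + assert (Hl' : IZR (up x) <= IZR l) by (apply IZR_le; lia).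
      eapply Rle_trans; [apply Rmin_l|].
      rewrite Rabs_minus_sym.
      eapply Rle_trans; [|apply Rle_abs].
      lra.
Qed.

(** The set of distances is nonempty and bounded below by 0, so its [Glb_Rbar] is finite and [real]
    does not fall back on a default value. *)
Lemma norm_RZ_glb (x : R) :
  (forall l : Z, norm_RZ x <= Rabs (x - IZR l)) /\
  (forall d : R, (forall l : Z, d <= Rabs (x - IZR l)) -> d <= norm_RZ x).
Proof.
  unfold norm_RZ.
  destruct (Glb_Rbar_correct (fun d => exists k : Z, d = Rabs (x - IZR k)))
    as [Hlb Hglb].
  destruct (Glb_Rbar (fun d => exists k : Z, d = Rabs (x - IZR k))) as [g| |];
    cbn [real].
  - split.
    + intros l.
      apply (Hlb (Rabs (x - IZR l))).
      now exists l.
    + intros d Hd.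
      apply (Hglb (Finite d)).
      intros y [k ->].
      apply Hd.
  - exfalso.
    apply (Hlb (Rabs (x - IZR 0))).
    now exists 0%Z.
  - exfalso.
    apply (Hglb (Finite 0)).
    intros y [k ->].
    apply Rabs_pos.
Qed.

Lemma irrational_mult_not_integer (alpha : R) (k l : Z) :
  irrational alpha -> k <> 0%Z -> IZR k * alpha <> IZR l.
Proof.
  intros Hirr Hk H.
  apply (Hirr l k Hk).
  rewrite <- H.
  field.
  now apply eq_IZR_contrapositive.
Qed.

Lemma irrational_multiples_bounded_below (alpha : R) (K : nat) :
  irrational alpha ->
  exists d : R, 0 < d /\
    forall (k : nat) (l : Z), (0 < k < K)%nat -> d <= Rabs (INR k * alpha - IZR l).
Proof.
  intros Hirr.
  induction K as [|K [d [Hd IH]]].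
  - exists 1.
    split; [lra|lia].
  - destruct (Nat.eq_dec K 0) as [->|HK].
    + exists 1.
      split; [lra|lia].
    + destruct (dist_to_integers_pos (INR K * alpha)) as [d' [Hd' Hl]].
      { intros l.
        rewrite INR_IZR_INZ.
        apply irrational_mult_not_integer; [assumption|lia]. }
      exists (Rmin d d').
      split; [now apply Rmin_glb_lt|].
      intros k l Hk.
      destruct (Nat.eq_dec k K) as [->|Hne].
      * eapply Rle_trans; [apply Rmin_r|apply Hl].
      * eapply Rle_trans; [apply Rmin_l|apply IH; lia].
Qed.

(** A bound strictly above an upper limit holds from some index on; the gap [b - l] serves as the
    epsilon. *)
Lemma beta_eventually (alpha b : R) :
  Rbar_lt (beta alpha) b ->
  exists N : nat, forall k : nat, (N <= k)%nat ->
    - ln (norm_RZ (INR k * alpha)) / INR k < b.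
Proof.
  unfold beta, LimSup_seq.
  destruct (ex_LimSup_seq _) as [[l| |] Hl]; simpl; intros Hb.
  - destruct (Hl (mkposreal (b - l) ltac:(lra))) as [_ [N HN]].
    exists N.
    intros k Hk.
    eapply Rlt_le_trans; [now apply HN|simpl; lra].
  - contradiction.
  - exact (Hl b).
Qed.

Lemma exp_le_compat (x y : R) : x <= y -> exp x <= exp y.
Proof.
  intros [H| ->]; [|lra].
  left.
  now apply exp_increasing.
Qed.

(** Positivity of beta makes [2 * beta] exceed it strictly, which handles all large [k]. The
    finitely many small [k] only lower the constant, and negative [k] reduce to positive ones by
    changing the sign of [l]. *)
Lemma diophantine_bound (alpha : R) :
  irrational alpha -> Rbar_lt 0 (beta alpha) -> Rbar_lt (beta alpha) p_infty ->
  exists c : R, 0 < c /\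
    forall (k l : Z), k <> 0%Z ->
      c * exp (- 2 * real (beta alpha) * IZR (Z.abs k)) <= Rabs (IZR k * alpha - IZR l).
Proof.
  intros Hirr Hpos Hfin.
  assert (Hb : 0 < real (beta alpha) /\
    Rbar_lt (beta alpha) (2 * real (beta alpha))).
  { destruct (beta alpha); simpl in *; try contradiction; lra. }
  destruct Hb as [Hb0 Hb].
  destruct (beta_eventually _ _ Hb) as [N HN].
  set (b := real (beta alpha)) in *.
  destruct (irrational_multiples_bounded_below alpha N Hirr) as [d [Hd Hsmall]].
  assert (Hnat : forall (k : nat) (l : Z), (0 < k)%nat ->
    Rmin d 1 * exp (- 2 * b * INR k) <= Rabs (INR k * alpha - IZR l)).
  { intros k l Hk.
    assert (HkR : 0 < INR k) by now apply lt_0_INR.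
    pose proof (exp_pos (- 2 * b * INR k)) as He.
    pose proof (Rmin_l d 1).
    pose proof (Rmin_r d 1).
    destruct (le_lt_dec N k) as [HNk|HNk].
    - destruct (norm_RZ_glb (INR k * alpha)) as [Hlb Hglb].
      eapply Rle_trans; [|apply Hlb].
      specialize (HN k HNk).
      set (nu := norm_RZ (INR k * alpha)) in *.
      assert (Hnu : 0 < nu).
      { destruct (dist_to_integers_pos (INR k * alpha)) as [d' [Hd' Hl]].
        { intros l'.
          rewrite INR_IZR_INZ.
          apply irrational_mult_not_integer; [assumption|lia]. }
        apply Rlt_le_trans with d'; auto. }
      (* For [k >= N] the bound holds with constant 1, and [Rmin d 1 <= 1]. *)
      apply Rle_trans with (exp (- 2 * b * INR k)); [nra|].
      rewrite <- (exp_ln nu Hnu).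
      left.
      apply exp_increasing.
      apply Rmult_lt_compat_r with (r := INR k) in HN; [|assumption].
      unfold Rdiv in HN.
      rewrite Rmult_assoc, Rinv_l in HN; lra.
    - apply Rle_trans with d; [|apply Hsmall; lia].
      assert (exp (- 2 * b * INR k) <= exp 0).
      { apply exp_le_compat.
        nra. }
      rewrite exp_0 in *.
      nra. }
  exists (Rmin d 1).
  split; [apply Rmin_glb_lt; lra|].
  intros k l Hk.
  destruct (Z_lt_le_dec k 0) as [Hneg|Hge].
  - replace (Rabs (IZR k * alpha - IZR l))
      with (Rabs (INR (Z.to_nat (Z.abs k)) * alpha - IZR (- l))).
    + replace (IZR (Z.abs k)) with (INR (Z.to_nat (Z.abs k)))
        by (rewrite INR_IZR_INZ; f_equal; lia).
      apply Hnat.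
      lia.
    + rewrite INR_IZR_INZ.
      replace (Z.of_nat (Z.to_nat (Z.abs k))) with (- k)%Z by lia.
      rewrite !opp_IZR.
      rewrite <- Rabs_Ropp.
      f_equal.
      ring.
  - replace (IZR k) with (INR (Z.to_nat (Z.abs k)))
      by (rewrite INR_IZR_INZ; f_equal; lia).
    replace (IZR (Z.abs k)) with (INR (Z.to_nat (Z.abs k)))
      by (rewrite INR_IZR_INZ; f_equal; lia).
    apply Hnat.
    lia.
Qed.

(** * Quadratic forms of Jacobi operators *)

Definition finitely_supported (u : Z -> R) : Prop :=
  exists N : nat, forall k : Z, (Z.of_nat N < Z.abs k)%Z -> u k = 0.

(** The split into two half-lines is that of [ell2_norm], so the two can be compared term by
    term. *)
Definition sumZ (u : Z -> R) : R :=
  Series (fun n : nat => u (Z.of_nat n)) +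
  Series (fun n : nat => u (- Z.of_nat (S n))%Z).

Lemma ex_series_eventually_zero (a : nat -> R) (N : nat) :
  (forall n : nat, (N < n)%nat -> a n = 0) -> ex_series a.
Proof.
  intros H.
  apply (ex_series_incr_n a (S N)).
  apply ex_series_ext with (fun n : nat => 0 * (/ 2) ^ n).
  - intros n.
    rewrite H by lia.
    apply Rmult_0_l.
  - apply (ex_series_scal_l (V := R_NormedModule) 0 (fun n => (/ 2) ^ n)).
    apply ex_series_geom.
    rewrite Rabs_pos_eq; lra.
Qed.

Lemma finitely_supported_ex_series (u : Z -> R) :
  finitely_supported u ->
  ex_series (fun n : nat => u (Z.of_nat n)) /\
  ex_series (fun n : nat => u (- Z.of_nat (S n))%Z).
Proof.
  intros [N HN].
  split; apply (ex_series_eventually_zero _ N); intros n Hn; apply HN; lia.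
Qed.

Lemma finitely_supported_plus (u v : Z -> R) :
  finitely_supported u -> finitely_supported v ->
  finitely_supported (fun k => u k + v k).
Proof.
  intros [N HN] [M HM].
  exists (N + M)%nat.
  intros k Hk.
  rewrite HN, HM by lia.
  ring.
Qed.

Lemma finitely_supported_mult_l (u v : Z -> R) :
  finitely_supported u -> finitely_supported (fun k => u k * v k).
Proof.
  intros [N HN].
  exists N.
  intros k Hk.
  rewrite HN by lia.
  ring.
Qed.

Lemma finitely_supported_mult_r (u v : Z -> R) :
  finitely_supported v -> finitely_supported (fun k => u k * v k).
Proof.
  intros [N HN].
  exists N.
  intros k Hk.
  rewrite HN by lia.
  ring.
Qed.

Lemma finitely_supported_shift (u : Z -> R) (j : Z) :
  finitely_supported u -> finitely_supported (fun k => u (k + j)%Z).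
Proof.
  intros [N HN].
  exists (N + Z.to_nat (Z.abs j))%nat.
  intros k Hk.
  apply HN.
  lia.
Qed.

Lemma sumZ_ext (u v : Z -> R) : (forall k, u k = v k) -> sumZ u = sumZ v.
Proof.
  intros H.
  unfold sumZ.
  f_equal; apply Series_ext; intros n; apply H.
Qed.

Lemma sumZ_plus (u v : Z -> R) :
  finitely_supported u -> finitely_supported v ->
  sumZ (fun k => u k + v k) = sumZ u + sumZ v.
Proof.
  intros Hu Hv.
  apply finitely_supported_ex_series in Hu, Hv.
  unfold sumZ.
  rewrite !Series_plus by tauto.
  ring.
Qed.

Lemma sumZ_scal (c : R) (u : Z -> R) : sumZ (fun k => c * u k) = c * sumZ u.
Proof.
  unfold sumZ.
  rewrite !Series_scal_l.
  ring.
Qed.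

Lemma sumZ_ge0 (u : Z -> R) :
  finitely_supported u -> (forall k, 0 <= u k) -> 0 <= sumZ u.
Proof.
  intros Hu H.
  apply finitely_supported_ex_series in Hu.
  replace 0 with (0 * sumZ u) by ring.
  rewrite <- sumZ_scal.
  unfold sumZ.
  apply Rplus_le_compat; apply Series_le; try tauto;
    intros n; rewrite Rmult_0_l; split; auto; lra.
Qed.

(** The shift moves the single term [u 0] from one half-line to the other; peeling it off both
    series leaves the same tails. *)
Lemma sumZ_shift (u : Z -> R) :
  finitely_supported u -> sumZ (fun k => u (k + 1)%Z) = sumZ u.
Proof.
  intros Hu.
  pose proof (finitely_supported_ex_series _ Hu) as [Hu1 _].
  pose proof (finitely_supported_ex_series _ (finitely_supported_shift u 1 Hu))
    as [_ Hu2].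
  unfold sumZ.
  rewrite (Series_incr_1 _ Hu1), (Series_incr_1 _ Hu2).
  rewrite (Series_ext (fun n => u (Z.of_nat n + 1)%Z) (fun n => u (Z.of_nat (S n))))
    by (intros n; f_equal; lia).
  rewrite (Series_ext (fun n => u (- Z.of_nat (S (S n)) + 1)%Z)
             (fun n => u (- Z.of_nat (S n))%Z))
    by (intros n; f_equal; lia).
  change (- Z.of_nat 1 + 1)%Z with 0%Z.
  change (Z.of_nat 0) with 0%Z.
  ring.
Qed.

Lemma Series_single (a : nat -> R) (j : nat) :
  (forall n : nat, n <> j -> a n = 0) -> Series a = a j.
Proof.
  revert a.
  induction j as [|j IH]; intros a Ha;
    (rewrite Series_incr_1;
     [|eapply ex_series_eventually_zero; intros n Hn; apply Ha;
       exact (Nat.neq_sym _ _ (Nat.lt_neq _ _ Hn))]).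
  - rewrite (Series_ext _ (fun n => 0 * 0)) by (intros n; rewrite Ha by lia; ring).
    rewrite Series_scal_l.
    ring.
  - rewrite (IH (fun k => a (S k))) by (intros n Hn; apply Ha; lia).
    rewrite (Ha 0%nat) by lia.
    ring.
Qed.

Lemma sumZ_single (u : Z -> R) (j : nat) :
  (forall k : Z, k <> Z.of_nat j -> u k = 0) -> sumZ u = u (Z.of_nat j).
Proof.
  intros Hu.
  unfold sumZ.
  rewrite (Series_single _ j) by (intros n Hn; apply Hu; lia).
  rewrite (Series_ext (fun n => u (- Z.of_nat (S n))%Z) (fun n => 0 * 0))
    by (intros n; rewrite Hu by lia; ring).
  rewrite Series_scal_l.
  ring.
Qed.

Definition dotZ (u v : Z -> R) : R := sumZ (fun k => u k * v k).

Definition jacobi (V : Z -> R) (u : Z -> R) (k : Z) : R :=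
  u (k + 1)%Z + u (k - 1)%Z + V k * u k.

Lemma finitely_supported_jacobi (V u : Z -> R) :
  finitely_supported u -> finitely_supported (jacobi V u).
Proof.
  intros Hu.
  unfold jacobi.
  repeat apply finitely_supported_plus.
  - now apply finitely_supported_shift.
  - now apply (finitely_supported_shift u (-1)).
  - now apply finitely_supported_mult_r.
Qed.

Lemma dotZ_ge0 (u : Z -> R) : finitely_supported u -> 0 <= dotZ u u.
Proof.
  intros Hu.
  apply sumZ_ge0; [now apply finitely_supported_mult_l|].
  intros k.
  nra.
Qed.

(** Removing the term at [j] leaves a nonnegative sum. A nonnegative site suffices, since the test
    sequences below are nonzero at 0 or 1. *)
Lemma dotZ_gt0 (u : Z -> R) (j : nat) :
  finitely_supported u -> u (Z.of_nat j) <> 0 -> 0 < dotZ u u.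
Proof.
  intros Hu Hj.
  set (d := fun k : Z => if Z.eq_dec k (Z.of_nat j) then u k * u k else 0).
  assert (Hd : finitely_supported d).
  { exists j.
    intros k Hk.
    unfold d.
    destruct Z.eq_dec; [lia|reflexivity]. }
  assert (Hdj : sumZ d = u (Z.of_nat j) * u (Z.of_nat j)).
  { rewrite (sumZ_single d j).
    - unfold d.
      now destruct Z.eq_dec.
    - intros k Hk.
      unfold d.
      now destruct Z.eq_dec. }
  assert (Hle : 0 <= sumZ (fun k => u k * u k + -1 * d k)).
  { apply sumZ_ge0.
    - apply finitely_supported_plus.
      + now apply finitely_supported_mult_l.
      + now apply finitely_supported_mult_r.
    - intros k.
      unfold d.
      destruct Z.eq_dec; nra. }
  rewrite sumZ_plus, sumZ_scal, Hdj in Hle.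
  - unfold dotZ.
    nra.
  - now apply finitely_supported_mult_l.
  - now apply finitely_supported_mult_r.
Qed.

Lemma dotZ_sym (u v : Z -> R) : dotZ u v = dotZ v u.
Proof.
  apply sumZ_ext.
  intros k.
  ring.
Qed.

Lemma dotZ_plus_l (u v w : Z -> R) :
  finitely_supported u -> finitely_supported v ->
  dotZ (fun k => u k + v k) w = dotZ u w + dotZ v w.
Proof.
  intros Hu Hv.
  unfold dotZ.
  rewrite <- sumZ_plus by now apply finitely_supported_mult_l.
  apply sumZ_ext.
  intros k.
  ring.
Qed.

Lemma dotZ_scal_l (c : R) (u w : Z -> R) :
  dotZ (fun k => c * u k) w = c * dotZ u w.
Proof.
  unfold dotZ.
  rewrite <- sumZ_scal.
  apply sumZ_ext.
  intros k.
  ring.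
Qed.

Lemma dotZ_ext_l (u v w : Z -> R) : (forall k, u k = v k) -> dotZ u w = dotZ v w.
Proof.
  intros H.
  apply sumZ_ext.
  intros k.
  now rewrite H.
Qed.

(** The potential term is symmetric, and a shift of the summation index exchanges the two hopping
    terms. *)
Lemma dotZ_jacobi_sym (V u v : Z -> R) :
  finitely_supported u -> finitely_supported v ->
  dotZ (jacobi V u) v = dotZ u (jacobi V v).
Proof.
  intros Hu Hv.
  assert (Hhop : forall a b : Z -> R, finitely_supported a ->
    sumZ (fun k => a (k + 1)%Z * b k) = sumZ (fun k => a k * b (k - 1)%Z)).
  { intros a b Ha.
    rewrite <- (sumZ_shift (fun k => a k * b (k - 1)%Z))
      by now apply finitely_supported_mult_l.
    apply sumZ_ext.
    intros k.
    do 2 f_equal.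
    lia. }
  assert (Hexpand : forall a b : Z -> R, finitely_supported a ->
    dotZ (jacobi V a) b =
    sumZ (fun k => a (k + 1)%Z * b k) + sumZ (fun k => a (k - 1)%Z * b k) +
    sumZ (fun k => V k * a k * b k)).
  { intros a b Ha.
    assert (H1 : finitely_supported (fun k => a (k + 1)%Z * b k))
      by now apply finitely_supported_mult_l, finitely_supported_shift.
    assert (H2 : finitely_supported (fun k => a (k - 1)%Z * b k))
      by now apply finitely_supported_mult_l, (finitely_supported_shift a (-1)).
    assert (H3 : finitely_supported (fun k => V k * a k * b k))
      by now apply finitely_supported_mult_l, finitely_supported_mult_r.
    rewrite <- !sumZ_plus by (try apply finitely_supported_plus; assumption).
    apply sumZ_ext.
    intros k.
    unfold jacobi.
    ring. }
  rewrite (dotZ_sym u), !Hexpand, !Hhop by assumption.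
  rewrite (sumZ_ext (fun k => u k * v (k - 1)%Z) (fun k => v (k - 1)%Z * u k))
    by (intros k; ring).
  rewrite (sumZ_ext (fun k => v k * u (k - 1)%Z) (fun k => u (k - 1)%Z * v k))
    by (intros k; ring).
  rewrite (sumZ_ext (fun k => V k * u k * v k) (fun k => V k * v k * u k))
    by (intros k; ring).
  ring.
Qed.

Lemma dotZ_jacobi_bound (V u : Z -> R) (M : R) :
  (forall k, Rabs (V k) <= M) -> finitely_supported u ->
  Rabs (dotZ (jacobi V u) u) <= (2 + M) * dotZ u u.
Proof.
  intros HV Hu.
  assert (Hp : finitely_supported (fun k => u (k + 1)%Z * u (k + 1)%Z))
    by now apply finitely_supported_mult_l, finitely_supported_shift.
  assert (Hm : finitely_supported (fun k => u (k - 1)%Z * u (k - 1)%Z))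
    by now apply finitely_supported_mult_l, (finitely_supported_shift u (-1)).
  assert (H0 : finitely_supported (fun k => u k * u k))
    by now apply finitely_supported_mult_l.
  assert (HJ : finitely_supported (fun k => jacobi V u k * u k))
    by now apply finitely_supported_mult_r.
  assert (Ep : sumZ (fun k => u (k + 1)%Z * u (k + 1)%Z) = dotZ u u)
    by exact (sumZ_shift (fun k => u k * u k) H0).
  assert (Em : sumZ (fun k => u (k - 1)%Z * u (k - 1)%Z) = dotZ u u).
  { rewrite <- (sumZ_shift _ Hm).
    apply sumZ_ext.
    intros k.
    now replace (k + 1 - 1)%Z with k by lia. }
  (* [2 |u_k u_l| <= u_k^2 + u_l^2] for the neighbours [l] of [k], and the shifted squares have
     the same sum. *)
  assert (Hs : forall s : R, s = 1 \/ s = -1 ->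
    s * dotZ (jacobi V u) u <= (2 + M) * dotZ u u).
  { intros s Hs.
    assert (Hle : 0 <= sumZ (fun k =>
      (/ 2 * (u (k + 1)%Z * u (k + 1)%Z) + / 2 * (u (k - 1)%Z * u (k - 1)%Z)) +
      ((1 + M) * (u k * u k) + - s * (jacobi V u k * u k)))).
    { apply sumZ_ge0.
      - repeat apply finitely_supported_plus;
          (apply finitely_supported_mult_r; assumption).
      - intros k.
        assert (HVk := HV k).
        apply Rabs_le_between in HVk.
        unfold jacobi.
        assert (Hab : 0 <= M * (u k * u k) - s * V k * (u k * u k))
          by (destruct Hs as [-> | ->]; nra).
        pose proof (Rle_0_sqr (u (k + 1)%Z - s * u k)) as Hp2.
        pose proof (Rle_0_sqr (u (k - 1)%Z - s * u k)) as Hm2.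
        unfold Rsqr in Hp2, Hm2.
        destruct Hs as [-> | ->]; lra. }
    rewrite !sumZ_plus, !sumZ_scal, Ep, Em in Hle;
      try (repeat apply finitely_supported_plus;
           apply finitely_supported_mult_r; assumption).
    fold (dotZ u u) in Hle.
    fold (dotZ (jacobi V u) u) in Hle.
    lra. }
  apply Rabs_le_between.
  pose proof (Hs 1 (or_introl eq_refl)).
  pose proof (Hs (-1) (or_intror eq_refl)).
  lra.
Qed.

(** The bridge from complex sequences to real finitely supported ones. Agreement is only pointwise
    because the resolvent identities are pointwise too. *)
Lemma ell2_norm_real (w : seqZ) (u : Z -> R) :
  finitely_supported u -> (forall k, w k = RtoC (u k)) ->
  in_ell2 w /\ ell2_norm w = sqrt (dotZ u u).
Proof.
  intros Hu Hw.
  assert (Hsq : forall k, Cmod (w k) ^ 2 = u k * u k).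
  { intros k.
    rewrite Hw, Cmod_R, <- Rsqr_pow2, <- Rsqr_abs.
    reflexivity. }
  destruct (finitely_supported_ex_series _ (finitely_supported_mult_l u u Hu))
    as [H1 H2].
  split.
  - split.
    + eapply ex_series_ext; [|exact H1].
      intros n.
      now rewrite Hsq.
    + eapply ex_series_ext; [|exact H2].
      intros n.
      now rewrite Hsq.
  - unfold ell2_norm, dotZ, sumZ.
    f_equal.
    f_equal; apply Series_ext; intros n; apply Hsq.
Qed.

(** With a bounded inverse [B] of [T - z], the norm of [u = B ((T - z) u)] is at most [M] times that
    of [(T - z) u]; then square. *)
Lemma resolvent_lower_bound (T : seqZ -> seqZ) (V : Z -> R) (z : R) :
  (forall (w : seqZ) (k : Z),
     T w k = Cplus (Cplus (w (k + 1)%Z) (w (k - 1)%Z)) (Cmult (RtoC (V k)) (w k))) ->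
  resolvent_set T (RtoC z) ->
  exists K : R, 0 < K /\ forall u : Z -> R, finitely_supported u ->
    dotZ u u <=
    K * dotZ (fun k => jacobi V u k + - z * u k) (fun k => jacobi V u k + - z * u k).
Proof.
  intros HT [B [[_ [M HM]] Hinv]].
  (* The summand 1 makes the constant positive even if [M = 0]. *)
  exists (M * M + 1).
  split; [nra|].
  intros u Hu.
  set (w := fun k => RtoC (u k)).
  destruct (ell2_norm_real w u Hu) as [Hw1 Hw2]; [reflexivity|].
  set (g := fun k => jacobi V u k + - z * u k).
  assert (Hg : finitely_supported g).
  { apply finitely_supported_plus.
    - now apply finitely_supported_jacobi.
    - now apply finitely_supported_mult_r. }
  destruct (Hinv w Hw1) as [HB _].
  set (Tw := fun n => Cminus (T w n) (Cmult (RtoC z) (w n))) in *.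
  destruct (ell2_norm_real Tw g Hg) as [Hg1 Hg2].
  { intros k.
    unfold Tw, g, w, jacobi.
    rewrite HT.
    rewrite !RtoC_plus, !RtoC_mult, RtoC_opp.
    ring. }
  destruct (HM Tw Hg1) as [_ Hle].
  destruct (ell2_norm_real (B Tw) u Hu) as [_ HB2]; [exact HB|].
  rewrite HB2, Hg2 in Hle.
  pose proof (dotZ_ge0 u Hu) as Hu0.
  pose proof (dotZ_ge0 g Hg) as Hg0.
  pose proof (sqrt_pos (dotZ u u)) as Hsu.
  pose proof (sqrt_pos (dotZ g g)) as Hsg.
  rewrite <- (sqrt_sqrt _ Hu0), <- (sqrt_sqrt _ Hg0).
  nra.
Qed.

(* The extremal value m of the form sigma <Hu,u> is attained in the spectrum: for the
   nonnegative operator P = sigma H - m with form bounded by K, 0 <= <P(u - Pu/K), u - Pu/K>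
   gives |Pu|^2 <= K <Pu,u>, so a bounded inverse of P would allow a larger m. *)
Lemma form_extremum_in_spectrum (T : seqZ -> seqZ) (V : Z -> R) (M sigma : R) :
  (forall (w : seqZ) (k : Z),
     T w k = Cplus (Cplus (w (k + 1)%Z) (w (k - 1)%Z)) (Cmult (RtoC (V k)) (w k))) ->
  (forall k, Rabs (V k) <= M) -> sigma * sigma = 1 ->
  exists m : R, spectrum T (RtoC (sigma * m)) /\
    forall u : Z -> R, finitely_supported u ->
      m * dotZ u u <= sigma * dotZ (jacobi V u) u.
Proof.
  intros HT HV Hsig.
  assert (Hs1 : sigma = 1 \/ sigma = -1).
  { destruct (Req_dec sigma 1); [tauto|].
    right.
    apply Rmult_eq_reg_l with (sigma - 1); nra. }
  assert (Hbd : forall u, finitely_supported u ->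
    - ((2 + M) * dotZ u u) <= sigma * dotZ (jacobi V u) u <= (2 + M) * dotZ u u).
  { intros u Hu.
    pose proof (dotZ_jacobi_bound V u M HV Hu) as H.
    apply Rabs_le_between in H.
    destruct Hs1 as [-> | ->]; lra. }
  set (X := fun m => forall u : Z -> R, finitely_supported u ->
      m * dotZ u u <= sigma * dotZ (jacobi V u) u).
  (* A nonzero test sequence, needed to bound the set [X] from above. *)
  set (delta := fun k : Z => if Z.eq_dec k 0 then 1 else 0).
  assert (Hdelta : finitely_supported delta).
  { exists 0%nat.
    intros k Hk.
    unfold delta.
    destruct Z.eq_dec; [lia|reflexivity]. }
  assert (Hdelta1 : 0 < dotZ delta delta).
  { apply (dotZ_gt0 _ 0); [assumption|].
    unfold delta.
    simpl.
    lra. }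
  destruct (completeness X) as [m [Hub Hlub]].
  { exists (2 + M).
    intros m Hm.
    specialize (Hm delta Hdelta).
    specialize (Hbd delta Hdelta).
    nra. }
  { exists (- (2 + M)).
    intros u Hu.
    specialize (Hbd u Hu).
    lra. }
  (* Every Rayleigh quotient is an upper bound of [X], so the supremum [m] still satisfies the
     inequality; for [dotZ u u = 0] the form vanishes by [Hbd]. *)
  assert (HmX : X m).
  { intros u Hu.
    destruct (Rle_lt_or_eq_dec _ _ (dotZ_ge0 u Hu)) as [Hpos|Hzero].
    - assert (Hm : m <= sigma * dotZ (jacobi V u) u / dotZ u u).
      { apply Hlub.
        intros m' Hm'.
        apply Rmult_le_reg_r with (dotZ u u); [assumption|].
        unfold Rdiv.
        rewrite Rmult_assoc, Rinv_l, Rmult_1_r by lra.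
        now apply Hm'. }
      apply Rmult_le_compat_r with (r := dotZ u u) in Hm; [|lra].
      unfold Rdiv in Hm.
      rewrite Rmult_assoc, Rinv_l, Rmult_1_r in Hm by lra.
      exact Hm.
    - specialize (Hbd u Hu).
      rewrite <- Hzero in *.
      lra. }
  exists m.
  split; [|exact HmX].
  intros Hres.
  destruct (resolvent_lower_bound T V (sigma * m) HT Hres) as [K0 [HK0 Hinv]].
  set (K := 2 + M + Rabs m).
  assert (HM0 : 0 <= M) by (eapply Rle_trans; [apply Rabs_pos|apply (HV 0%Z)]).
  assert (HK : 0 < K) by (unfold K; pose proof (Rabs_pos m); lra).
  set (P := fun (u : Z -> R) k => sigma * jacobi V u k + - m * u k).
  assert (HPfs : forall u, finitely_supported u -> finitely_supported (P u)).
  { intros u Hu.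
    apply finitely_supported_plus; apply finitely_supported_mult_r;
      [now apply finitely_supported_jacobi|assumption]. }
  assert (HPdot : forall u w, finitely_supported u ->
    dotZ (P u) w = sigma * dotZ (jacobi V u) w - m * dotZ u w).
  { intros u w Hu.
    unfold P.
    rewrite dotZ_plus_l.
    - rewrite !dotZ_scal_l.
      ring.
    - apply finitely_supported_mult_r.
      now apply finitely_supported_jacobi.
    - now apply finitely_supported_mult_r. }
  assert (HPsym : forall u w, finitely_supported u -> finitely_supported w ->
    dotZ (P u) w = dotZ (P w) u).
  { intros u w Hu Hw.
    rewrite !HPdot, dotZ_jacobi_sym, (dotZ_sym u w), (dotZ_sym u) by assumption.
    reflexivity. }
  assert (HPpos : forall u, finitely_supported u -> 0 <= dotZ (P u) u).
  { intros u Hu.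
    rewrite HPdot by assumption.
    specialize (HmX u Hu).
    lra. }
  assert (HPbd : forall u, finitely_supported u -> dotZ (P u) u <= K * dotZ u u).
  { intros u Hu.
    rewrite HPdot by assumption.
    specialize (Hbd u Hu).
    pose proof (dotZ_ge0 u Hu).
    pose proof (Rle_abs (- m)) as Hm.
    rewrite Rabs_Ropp in Hm.
    unfold K.
    nra. }
  assert (HPsq : forall u, finitely_supported u ->
    dotZ (P u) (P u) <= K * dotZ (P u) u).
  { intros u Hu.
    (* This [t] makes the quadratic term at most [|Pu|^2 / K], half the size of the cross term
       [- 2 |Pu|^2 / K]. *)
    set (t := - / K).
    set (w := P u).
    assert (Hw : finitely_supported w) by now apply HPfs.
    set (v := fun k => u k + t * w k).
    assert (Htw : finitely_supported (fun k => t * w k))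
      by now apply finitely_supported_mult_r.
    assert (Hv : finitely_supported v) by now apply finitely_supported_plus.
    pose proof (HPpos v Hv) as Hpos.
    assert (Hexp : dotZ (P v) v =
      dotZ w u + 2 * t * dotZ w w + t * t * dotZ (P w) w).
    { assert (Hvr : forall a, dotZ a v = dotZ a u + t * dotZ a w).
      { intros a.
        rewrite (dotZ_sym a v), (dotZ_sym a u), (dotZ_sym a w).
        unfold v.
        now rewrite dotZ_plus_l, dotZ_scal_l. }
      rewrite (dotZ_ext_l (P v) (fun k => w k + t * P w k)).
      2:{ intros k.
          unfold v, w, P, jacobi.
          ring. }
      rewrite dotZ_plus_l, dotZ_scal_l
        by (try apply finitely_supported_mult_r; try apply HPfs; assumption).
      rewrite !Hvr, (HPsym w u) by assumption.
      fold w.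
      ring. }
    rewrite Hexp in Hpos.
    pose proof (HPbd w Hw) as Hww.
    assert (HtK : t * K = -1) by (unfold t; field; lra).
    assert (Ht2 : t * t * dotZ (P w) w <= - t * dotZ w w).
    { replace (- t * dotZ w w) with (t * t * (K * dotZ w w))
        by (replace (t * t * (K * dotZ w w)) with (t * (t * K) * dotZ w w) by ring;
            rewrite HtK; ring).
      apply Rmult_le_compat_l; [nra|assumption]. }
    assert (Hlast : 0 <= K * (dotZ w u + t * dotZ w w))
      by (apply Rmult_le_pos; lra).
    rewrite Rmult_plus_distr_l, <- Rmult_assoc, (Rmult_comm K t), HtK in Hlast.
    lra. }
  (* Chaining the two estimates gives [|u|^2 <= K0 |Pu|^2 <= K0 K <Pu,u>], so the form of [P] is at
     least [eps |u|^2] and [m] can be raised by [eps]. *)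
  set (eps := / (K0 * K)).
  assert (Heps : 0 < eps) by (apply Rinv_0_lt_compat; nra).
  assert (Hbig : X (m + eps)).
  { intros u Hu.
    pose proof (Hinv u Hu) as Hle.
    (* Since [sigma] is 1 or -1, [H - sigma m] is [sigma P], and the sign disappears in the
       square. *)
    assert (Hsame : dotZ (fun k => jacobi V u k + - (sigma * m) * u k)
                         (fun k => jacobi V u k + - (sigma * m) * u k)
                    = dotZ (P u) (P u)).
    { apply sumZ_ext.
      intros k.
      unfold P.
      destruct Hs1 as [-> | ->]; ring. }
    rewrite Hsame in Hle.
    pose proof (HPsq u Hu) as Hsq.
    rewrite (HPdot u u) in Hsq by assumption.
    assert (Hd : dotZ u u <=
      K0 * K * (sigma * dotZ (jacobi V u) u - m * dotZ u u)) by nra.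
    apply Rmult_le_compat_l with (r := eps) in Hd; [|lra].
    rewrite <- Rmult_assoc in Hd.
    unfold eps in Hd at 2.
    rewrite Rinv_l, Rmult_1_l in Hd by nra.
    lra. }
  specialize (Hub _ Hbig).
  lra.
Qed.

(** * The lifted Schroedinger cocycle *)

(** The expansion converges at distance [r / 2], where its terms would not tend to 0 if the radius
    of convergence were smaller. So the radius is positive and the power series is continuous at its
    centre. *)
Lemma analytic_at_continuity_pt (f : R -> R) (x : R) :
  analytic_at (K := R_AbsRing) f x -> continuity_pt f x.
Proof.
  intros [r [a Ha]].
  assert (Habs : forall w : R, Rabs (w - x) < r -> PSeries a (w - x) = f w).
  { intros w Hw.
    apply is_pseries_unique.
    exact (Ha w Hw). }
  assert (Hr : 0 < r) by apply cond_pos.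
  assert (Hrad : Rbar_lt (Rabs 0) (CV_radius a)).
  { apply Rbar_lt_le_trans with (Finite (r / 2)).
    - rewrite Rabs_R0.
      simpl.
      lra.
    - apply Rbar_not_lt_le.
      intros Hlt.
      assert (Hin : Rabs (x + r / 2 - x) < r)
        by (replace (x + r / 2 - x) with (r / 2) by ring; rewrite Rabs_pos_eq; lra).
      apply (CV_disk_outside a (x + r / 2 - x)).
      + replace (x + r / 2 - x) with (r / 2) by ring.
        rewrite Rabs_pos_eq by lra.
        exact Hlt.
      + apply ex_series_lim_0.
        exists (f (x + r / 2)).
        apply (is_pseries_R a).
        exact (Ha (x + r / 2) Hin). }
  pose proof (PSeries_continuity a 0 Hrad) as Hc.
  apply continuity_pt_ext_loc with (fun w => PSeries a (w - x)).
  - exists r.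
    intros w Hw.
    apply Habs.
    exact Hw.
  - apply (continuity_pt_comp (fun w => w - x) (PSeries a)).
    + apply continuity_pt_minus; [apply continuity_pt_id|].
      apply continuity_pt_const.
      now intros ? ?.
    + replace (x - x) with 0 by ring.
      exact Hc.
Qed.

Lemma periodic_IZR (f : R -> R) (x : R) (k : Z) :
  (forall x, f (x + 1) = f x) -> f (x + IZR k) = f x.
Proof.
  intros Hper.
  assert (Hnat : forall (n : nat) (x : R), f (x + INR n) = f x).
  { induction n as [|n IH]; intros y.
    - now rewrite Rplus_0_r.
    - rewrite S_INR, <- Rplus_assoc, Hper.
      apply IH. }
  destruct (Z_le_gt_dec 0 k) as [Hk|Hk].
  - rewrite <- (Z2Nat.id k Hk), <- INR_IZR_INZ.
    apply Hnat.
  - rewrite <- (Hnat (Z.to_nat (- k)) (x + IZR k)).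
    f_equal.
    rewrite INR_IZR_INZ, Z2Nat.id, opp_IZR by lia.
    ring.
Qed.

Lemma continuous_periodic_bounded (f : R -> R) :
  (forall x, f (x + 1) = f x) -> (forall x, continuity_pt f x) ->
  exists M : R, forall x, Rabs (f x) <= M.
Proof.
  intros Hper Hcont.
  destruct (continuity_ab_maj (fun x => Rabs (f x)) 0 1) as [xm [Hxm _]].
  - lra.
  - intros c _.
    apply (continuity_pt_comp f Rabs); [apply Hcont|apply Rcontinuity_abs].
  - exists (Rabs (f xm)).
    intros x.
    destruct (archimed x) as [H1 H2].
    rewrite <- (periodic_IZR f x (- (up x - 1)) Hper).
    apply Hxm.
    rewrite opp_IZR, minus_IZR.
    lra.
Qed.

(* The matrix [c, -1; 1, 0] is a quarter turn after the shear (a, b) |-> (a, b - c a).  The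
   shear moves no direction to its opposite, so its rotation angle is
   2 atan (cross / (norm + dot)), computed from v = (a, b) and its image. *)
Definition shear_norm (c y : R) : R :=
  sqrt (cos (2 * PI * y) ^ 2 + (sin (2 * PI * y) - c * cos (2 * PI * y)) ^ 2).

Definition shear_dot (c y : R) : R := 1 - c * (cos (2 * PI * y) * sin (2 * PI * y)).

Definition schrodinger_psi (c y : R) : R :=
  1 / 4 + atan (- c * cos (2 * PI * y) ^ 2 * / (shear_norm c y + shear_dot c y)) * / PI.

(** With [a] and [b] the cosine and sine, the square of the norm is the square of the dot product
    plus that of the cross product [- c a^2]. If norm plus dot were not positive, the cross product
    would vanish, hence [c a = 0], making the dot product 1. *)
Lemma shear_norm_spec (c y : R) :
  0 < shear_norm c y /\ 0 < shear_norm c y + shear_dot c y /\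
  shear_norm c y * shear_norm c y =
    cos (2 * PI * y) ^ 2 + (sin (2 * PI * y) - c * cos (2 * PI * y)) ^ 2.
Proof.
  unfold shear_norm, shear_dot.
  pose proof (sin2_cos2 (2 * PI * y)) as H.
  unfold Rsqr in H.
  set (a := cos (2 * PI * y)) in *.
  set (b := sin (2 * PI * y)) in *.
  assert (Hq : 0 <= a ^ 2 + (b - c * a) ^ 2)
    by (apply Rplus_le_le_0_compat; apply pow2_ge_0).
  pose proof (sqrt_pos (a ^ 2 + (b - c * a) ^ 2)) as Hs.
  pose proof (sqrt_sqrt _ Hq) as Hss.
  set (N := sqrt (a ^ 2 + (b - c * a) ^ 2)) in *.
  assert (HN : 0 < N).
  { destruct Hs as [Hs|Hs]; [assumption|].
    exfalso.
    rewrite <- Hs in Hss.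
    pose proof (pow2_ge_0 a).
    pose proof (pow2_ge_0 (b - c * a)).
    assert (Ha : a = 0) by (apply Rsqr_0_uniq; unfold Rsqr; lra).
    assert (Hb : b - c * a = 0) by (apply Rsqr_0_uniq; unfold Rsqr; lra).
    rewrite Ha in *.
    assert (Hb0 : b = 0) by lra.
    rewrite Hb0 in H.
    lra. }
  split; [assumption|].
  split; [|assumption].
  assert (HNd : N * N = (1 - c * (a * b)) ^ 2 + (c * a ^ 2) ^ 2).
  { rewrite Hss.
    replace ((1 - c * (a * b)) ^ 2 + (c * a ^ 2) ^ 2)
      with (1 - 2 * c * (a * b) + c ^ 2 * a ^ 2 * (b * b + a * a)) by ring.
    rewrite H.
    replace (a ^ 2 + (b - c * a) ^ 2)
      with ((b * b + a * a) - 2 * c * (a * b) + c ^ 2 * a ^ 2) by ring.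
    rewrite H.
    ring. }
  destruct (Rlt_le_dec 0 (N + (1 - c * (a * b)))) as [Hlt|Hle]; [assumption|].
  exfalso.
  assert (Hca : c * a ^ 2 = 0) by nra.
  assert (Hca0 : c * a = 0).
  { destruct (Req_dec a 0) as [Ha|Ha]; [rewrite Ha; ring|].
    apply Rmult_eq_reg_r with a; [|assumption].
    lra. }
  replace (c * (a * b)) with ((c * a) * b) in Hle by ring.
  rewrite Hca0 in Hle.
  lra.
Qed.

(** A quarter turn plus a shear rotation of less than a half turn either way. This fixes the branch
    of the angle when orbits are followed. *)
Lemma schrodinger_psi_bound (c y : R) : - (1 / 4) < schrodinger_psi c y < 3 / 4.
Proof.
  unfold schrodinger_psi.
  set (t := _ * / (shear_norm c y + shear_dot c y)).
  destruct (atan_bound t) as [H1 H2].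
  pose proof PI_RGT_0 as Hpi.
  assert (Hinv : 0 < / PI) by now apply Rinv_0_lt_compat.
  apply Rmult_lt_compat_r with (r := / PI) in H1, H2; try assumption.
  replace (- PI / 2 * / PI) with (- (1 / 2)) in H1 by (field; lra).
  replace (PI / 2 * / PI) with (1 / 2) in H2 by (field; lra).
  lra.
Qed.

Lemma cos_sin_double_atan (t : R) :
  cos (2 * atan t) = (1 - t ^ 2) / (1 + t ^ 2) /\
  sin (2 * atan t) = 2 * t / (1 + t ^ 2).
Proof.
  assert (Hp : 0 < 1 + t ^ 2) by nra.
  rewrite cos_2a, sin_2a, sin_atan, cos_atan.
  replace (1 + t²) with (1 + t ^ 2) by (unfold Rsqr; ring).
  pose proof (sqrt_lt_R0 _ Hp) as Hs.
  pose proof (sqrt_sqrt (1 + t ^ 2) ltac:(lra)) as Hss.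
  set (s := sqrt (1 + t ^ 2)) in *.
  split; rewrite <- Hss; field; lra.
Qed.

(** For [N^2 = d^2 + s^2] and [t = s / (N + d)], the half-angle formulas give [d / N] and [s / N] as
    cosine and sine of [2 atan t]. Rotating by this angle and a quarter turn yields the image
    divided by its norm [N]. *)
Lemma schrodinger_psi_direction (c y : R) :
  exists r : R, 0 < r /\
    c * cos (2 * PI * y) - sin (2 * PI * y) = r * cos (2 * PI * (y + schrodinger_psi c y)) /\
    cos (2 * PI * y) = r * sin (2 * PI * (y + schrodinger_psi c y)).
Proof.
  destruct (shear_norm_spec c y) as (HN & HNd & HNN).
  exists (shear_norm c y).
  split; [assumption|].
  unfold schrodinger_psi.
  set (t := _ * / (shear_norm c y + shear_dot c y)).
  pose proof PI_RGT_0 as Hpi.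
  replace (2 * PI * (y + (1 / 4 + atan t * / PI)))
    with ((2 * PI * y + 2 * atan t) + PI / 2) by (field; lra).
  rewrite (cos_plus _ (PI / 2)), (sin_plus _ (PI / 2)), cos_PI2, sin_PI2.
  rewrite cos_plus, sin_plus.
  destruct (cos_sin_double_atan t) as [-> ->].
  pose proof (sin2_cos2 (2 * PI * y)) as H.
  unfold Rsqr in H.
  unfold shear_dot in *.
  set (a := cos (2 * PI * y)) in *.
  set (b := sin (2 * PI * y)) in *.
  set (N := shear_norm c y) in *.
  set (d := 1 - c * (a * b)) in *.
  set (s := - c * a ^ 2) in *.
  assert (HNd2 : N * N = d * d + s * s).
  { rewrite HNN.
    unfold d, s.
    replace ((1 - c * (a * b)) * (1 - c * (a * b)) + - c * a ^ 2 * (- c * a ^ 2))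
      with (1 - 2 * c * (a * b) + c ^ 2 * a ^ 2 * (b * b + a * a)) by ring.
    rewrite H.
    replace (a ^ 2 + (b - c * a) ^ 2)
      with ((b * b + a * a) - 2 * c * (a * b) + c ^ 2 * a ^ 2) by ring.
    rewrite H.
    ring. }
  assert (Hden : (N + d) ^ 2 + s ^ 2 = 2 * N * (N + d)) by nra.
  assert (Hden0 : 0 < 2 * N * (N + d)) by (apply Rmult_lt_0_compat; lra).
  assert (Hcos : (1 - t ^ 2) / (1 + t ^ 2) = d / N).
  { replace ((1 - t ^ 2) / (1 + t ^ 2))
      with (((N + d) ^ 2 - s ^ 2) / ((N + d) ^ 2 + s ^ 2)).
    - rewrite Hden.
      replace ((N + d) ^ 2 - s ^ 2) with (2 * d * (N + d)) by nra.
      field; lra.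
    - unfold t.
      field.
      split; lra. }
  assert (Hsin : 2 * t / (1 + t ^ 2) = s / N).
  { replace (2 * t / (1 + t ^ 2))
      with (2 * s * (N + d) / ((N + d) ^ 2 + s ^ 2)).
    - rewrite Hden.
      field; lra.
    - unfold t.
      field.
      split; lra. }
  rewrite Hcos, Hsin.
  unfold d, s.
  split.
  - replace (N * _) with (c * a * (b * b + a * a) - b) by (field; lra).
    rewrite H.
    ring.
  - replace (N * _) with a by (field; lra).
    reflexivity.
Qed.

Lemma continuity_2d_pt_slices (g : R -> R -> R) (x y : R) :
  continuity_2d_pt g x y ->
  continuity_pt (fun v => g x v) y /\ continuity_pt (fun u => g u y) x.
Proof.
  intros Hg.
  split; apply continuity_pt_locally; intros eps; destruct (Hg eps) as [d Hd];
    exists d; intros v Hv; apply Hd; try exact Hv;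
    rewrite Rminus_diag, Rabs_R0; apply cond_pos.
Qed.

Lemma cos_2PI_periodic (y : R) : cos (2 * PI * (y + 1)) = cos (2 * PI * y).
Proof.
  rewrite <- (cos_period (2 * PI * y) 1).
  f_equal.
  simpl.
  ring.
Qed.

Lemma sin_2PI_periodic (y : R) : sin (2 * PI * (y + 1)) = sin (2 * PI * y).
Proof.
  rewrite <- (sin_period (2 * PI * y) 1).
  f_equal.
  simpl.
  ring.
Qed.

Lemma schrodinger_psi_lift (c : R -> R) :
  (forall x, c (x + 1) = c x) -> (forall x, continuity_pt c x) ->
  cocycle_lift (fun x => Mat2 (c x) (-1) 1 0) (fun x y => schrodinger_psi (c x) y).
Proof.
  intros Hper Hcont.
  split; [|split].
  - intros x y.
    assert (Hc : continuity_2d_pt (fun u _ => c u) x y).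
    { apply (continuity_1d_2d_pt_comp c (fun u _ => u)); [apply Hcont|].
      apply continuity_2d_pt_id1. }
    assert (Harg : continuity_2d_pt (fun _ v => 2 * PI * v) x y).
    { apply (continuity_2d_pt_mult (fun _ _ => 2 * PI) (fun _ v => v)).
      - apply continuity_2d_pt_const.
      - apply continuity_2d_pt_id2. }
    assert (Hcos : continuity_2d_pt (fun _ v => cos (2 * PI * v)) x y).
    { apply (continuity_1d_2d_pt_comp cos (fun _ v => 2 * PI * v));
        [apply continuity_cos|exact Harg]. }
    assert (Hsin : continuity_2d_pt (fun _ v => sin (2 * PI * v)) x y).
    { apply (continuity_1d_2d_pt_comp sin (fun _ v => 2 * PI * v));
        [apply continuity_sin|exact Harg]. }
    assert (Hsq : forall g, continuity_2d_pt g x y ->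
      continuity_2d_pt (fun u v => g u v ^ 2) x y).
    { intros g Hg.
      apply continuity_2d_pt_ext with (fun u v => g u v * g u v).
      - intros u v.
        ring.
      - now apply continuity_2d_pt_mult. }
    destruct (shear_norm_spec (c x) y) as (HN & HNd & HNN).
    unfold schrodinger_psi.
    apply continuity_2d_pt_plus; [apply continuity_2d_pt_const|].
    apply continuity_2d_pt_mult; [|apply continuity_2d_pt_const].
    apply (continuity_1d_2d_pt_comp atan).
    { apply derivable_continuous_pt.
      apply derivable_pt_atan. }
    apply continuity_2d_pt_mult.
    { apply continuity_2d_pt_mult; [now apply continuity_2d_pt_opp|].
      now apply Hsq. }
    apply continuity_2d_pt_inv; [|lra].
    apply continuity_2d_pt_plus.
    + unfold shear_norm.
      apply (continuity_1d_2d_pt_comp sqrt).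
      * apply continuity_pt_sqrt.
        apply Rplus_le_le_0_compat; apply pow2_ge_0.
      * apply continuity_2d_pt_plus; [now apply Hsq|].
        apply (Hsq (fun u v => sin (2 * PI * v) - c u * cos (2 * PI * v))).
        apply continuity_2d_pt_minus; [assumption|].
        now apply continuity_2d_pt_mult.
    + unfold shear_dot.
      apply continuity_2d_pt_minus; [apply continuity_2d_pt_const|].
      apply continuity_2d_pt_mult; [assumption|].
      now apply continuity_2d_pt_mult.
  - intros x y.
    rewrite Hper.
    split; [reflexivity|].
    unfold schrodinger_psi, shear_norm, shear_dot.
    now rewrite cos_2PI_periodic, sin_2PI_periodic.
  - intros x y.
    destruct (schrodinger_psi_direction (c x) y) as [r (Hr & H1 & H2)].
    exists r.
    split; [assumption|].
    unfold mat2_act, direction.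
    simpl.
    f_equal; lra.
Qed.

(* Compare y and z = y + s with s in (0, 1/2): the cross product of the image directions has
   the sign of that of the directions, so the lifted difference cannot take a value
   in [-1/4, 0). *)
Lemma cocycle_lift_increasing (A : R -> mat2) (psi : R -> R -> R) (x y z : R) :
  cocycle_lift A psi -> 0 < m11 (A x) * m22 (A x) - m12 (A x) * m21 (A x) ->
  y <= z -> y + psi x y <= z + psi x z.
Proof.
  intros (Hcont & _ & Hdir) Hdet.
  pose proof PI_RGT_0 as Hpi.
  set (F := fun v => v + psi x v).
  change (y <= z -> F y <= F z).
  assert (HF : continuity F).
  { intros v.
    apply continuity_pt_plus; [apply continuity_pt_id|].
    apply (continuity_2d_pt_slices psi x v).
    apply Hcont. }
  assert (Hsin : forall v w, v < w < v + 1 / 2 -> 0 < sin (2 * PI * (F w - F v))).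
  { intros v w Hvw.
    destruct (Hdir x v) as [r [Hr Hv]].
    destruct (Hdir x w) as [r' [Hr' Hw]].
    unfold mat2_act, direction in Hv, Hw.
    simpl in Hv, Hw.
    injection Hv as Hv1 Hv2.
    injection Hw as Hw1 Hw2.
    fold (F v) in Hv1, Hv2.
    fold (F w) in Hw1, Hw2.
    assert (Hs : 0 < sin (2 * PI * (w - v))) by (apply sin_gt_0; nra).
    rewrite Rmult_minus_distr_l, sin_minus in *.
    set (cv := cos (2 * PI * v)) in *.
    set (sv := sin (2 * PI * v)) in *.
    set (cw := cos (2 * PI * w)) in *.
    set (sw := sin (2 * PI * w)) in *.
    assert (Heq : r * r' * (sin (2 * PI * F w) * cos (2 * PI * F v)
                            - cos (2 * PI * F w) * sin (2 * PI * F v)) =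
      (m11 (A x) * m22 (A x) - m12 (A x) * m21 (A x)) * (sw * cv - cw * sv)).
    { transitivity ((r' * sin (2 * PI * F w)) * (r * cos (2 * PI * F v))
                    - (r' * cos (2 * PI * F w)) * (r * sin (2 * PI * F v))).
      - ring.
      - rewrite <- Hv1, <- Hv2, <- Hw1, <- Hw2.
        ring. }
    assert (Hrr : 0 < r * r') by now apply Rmult_lt_0_compat.
    apply Rmult_lt_reg_l with (r * r'); [assumption|].
    rewrite Rmult_0_r, Heq.
    now apply Rmult_lt_0_compat. }
  assert (Hstep : forall v w, v <= w < v + 1 / 2 -> F v <= F w).
  { intros v w [[Hlt| ->] Hw]; [|apply Rle_refl].
    destruct (Rle_lt_dec (F v) (F w)) as [Hle|Hbad]; [assumption|].
    exfalso.
    (* The maximum keeps [t] between [F w] and [F v], hence attained, and at most a quarter turn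
       below [F v], where the sine is negative, however large the drop. *)
    set (t := Rmax (F w) (F v - 1 / 4)).
    assert (Ht : F v - 1 / 4 <= t < F v)
      by (split; [apply Rmax_r|apply Rmax_lub_lt; lra]).
    destruct (IVT_gen F v w t HF) as [s [Hs1 Hs2]].
    { rewrite Rmin_right, Rmax_left by lra.
      split; [apply Rmax_l|lra]. }
    rewrite Rmin_left, Rmax_right in Hs1 by lra.
    assert (Hsv : v <> s) by (intros <-; lra).
    assert (Hpos : 0 < sin (2 * PI * (F s - F v))) by (apply Hsin; lra).
    assert (Hneg : sin (2 * PI * (F s - F v)) < 0)
      by (apply sin_lt_0_var; rewrite Hs2; nra).
    lra. }
  (* Longer intervals are crossed in steps of 1/4, which the local monotonicity covers. *)
  assert (Hmany : forall (n : nat) v w, v <= w < v + INR n / 4 -> F v <= F w).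
  { induction n as [|n IH]; intros v w Hvw.
    - simpl in Hvw.
      lra.
    - rewrite S_INR in Hvw.
      destruct (Rlt_le_dec w (v + 1 / 2)) as [Hw|Hw]; [apply Hstep; lra|].
      apply Rle_trans with (F (v + 1 / 4)); [apply Hstep; lra|].
      apply IH.
      lra. }
  intros Hyz.
  destruct (INR_unbounded (4 * (z - y))) as [n Hn].
  apply (Hmany n).
  lra.
Qed.

(** Two different integer values would force the half-integer just above the smaller one to be
    attained; doubling gives a parity contradiction. *)
Lemma continuous_integer_valued_constant (g : R -> R) (s t : R) :
  continuity g -> (forall x, exists k : Z, g x = IZR k) -> g s = g t.
Proof.
  intros Hg Hint.
  destruct (Req_dec (g s) (g t)) as [Heq|Hne]; [assumption|].
  exfalso.
  destruct (Hint s) as [k Hk].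
  destruct (Hint t) as [l Hl].
  assert (Hkl : (Z.min k l + 1 <= Z.max k l)%Z).
  { assert (k <> l) by (intros ->; congruence).
    lia. }
  assert (Hmm : Rmin (g s) (g t) = IZR (Z.min k l) /\ Rmax (g s) (g t) = IZR (Z.max k l)).
  { rewrite Hk, Hl.
    destruct (Z_le_gt_dec k l) as [H|H].
    - assert (IZR k <= IZR l) by now apply IZR_le.
      rewrite Rmin_left, Rmax_right, Z.min_l, Z.max_r by (assumption || lia).
      tauto.
    - assert (IZR l <= IZR k) by (apply IZR_le; lia).
      rewrite Rmin_right, Rmax_left, Z.min_r, Z.max_l by (assumption || lia).
      tauto. }
  apply IZR_le in Hkl.
  rewrite plus_IZR in Hkl.
  destruct (IVT_gen g s t (IZR (Z.min k l) + 1 / 2) Hg) as [x [_ Hx]].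
  { destruct Hmm as [-> ->].
    lra. }
  destruct (Hint x) as [i Hi].
  assert (Habs : IZR (2 * i) = IZR (2 * Z.min k l + 1))
    by (rewrite plus_IZR, !mult_IZR; lra).
  apply eq_IZR in Habs.
  lia.
Qed.

(** Taking norms gives [r = r']. Then the cosine of [2 PI (y - z)] is 1, so the sine of [PI (y - z)]
    vanishes. *)
Lemma direction_colinear (r r' y z : R) :
  0 < r -> 0 < r' ->
  r * cos (2 * PI * y) = r' * cos (2 * PI * z) ->
  r * sin (2 * PI * y) = r' * sin (2 * PI * z) ->
  exists k : Z, y - z = IZR k.
Proof.
  intros Hr Hr' Hc Hs.
  pose proof PI_RGT_0 as Hpi.
  pose proof (sin2_cos2 (2 * PI * y)) as Hy.
  pose proof (sin2_cos2 (2 * PI * z)) as Hz.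
  unfold Rsqr in *.
  assert (Hsq : r * r = r' * r').
  { transitivity ((r * cos (2 * PI * y)) * (r * cos (2 * PI * y)) +
                  (r * sin (2 * PI * y)) * (r * sin (2 * PI * y))).
    - replace (r * r) with (r * r * 1) by ring.
      rewrite <- Hy.
      ring.
    - rewrite Hc, Hs.
      replace (r' * r') with (r' * r' * 1) by ring.
      rewrite <- Hz.
      ring. }
  assert (Hrr : r = r') by nra.
  subst r'.
  apply Rmult_eq_reg_l in Hc, Hs; try lra.
  assert (Hcos : cos (2 * (PI * (y - z))) = 1).
  { replace (2 * (PI * (y - z))) with (2 * PI * y - 2 * PI * z) by ring.
    rewrite cos_minus, Hc, Hs.
    lra. }
  rewrite cos_2a_sin in Hcos.
  assert (Hsin : sin (PI * (y - z)) = 0).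
  { apply Rsqr_0_uniq.
    unfold Rsqr.
    lra. }
  destruct (sin_eq_0_0 _ Hsin) as [k Hk].
  exists k.
  apply Rmult_eq_reg_l with PI; lra.
Qed.

(** The difference is continuous and integer valued; it is followed from [(0, 0)] to [(x, 0)] and
    then to [(x, y)], so that one-variable continuity suffices. *)
Lemma cocycle_lift_unique (A : R -> mat2) (psi psi' : R -> R -> R) :
  cocycle_lift A psi -> cocycle_lift A psi' ->
  exists k : Z, forall x y : R, psi' x y = psi x y + IZR k.
Proof.
  intros (Hcont & _ & Hdir) (Hcont' & _ & Hdir').
  assert (Hint : forall x y, exists k : Z, psi' x y - psi x y = IZR k).
  { intros x y.
    destruct (Hdir x y) as [r [Hr H]].
    destruct (Hdir' x y) as [r' [Hr' H']].
    rewrite H in H'.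
    unfold direction in H'.
    simpl in H'.
    injection H' as H1 H2.
    destruct (direction_colinear r' r (y + psi' x y) (y + psi x y)) as [k Hk];
      try assumption; try (symmetry; assumption).
    exists k.
    lra. }
  destruct (Hint 0 0) as [k Hk].
  exists k.
  intros x y.
  assert (Hx : psi' 0 0 - psi 0 0 = psi' x 0 - psi x 0).
  { apply (continuous_integer_valued_constant (fun u => psi' u 0 - psi u 0)).
    - intros u.
      apply continuity_pt_minus;
        apply (continuity_2d_pt_slices _ u 0); [apply Hcont'|apply Hcont].
    - intros u.
      apply Hint. }
  assert (Hy : psi' x 0 - psi x 0 = psi' x y - psi x y).
  { apply (continuous_integer_valued_constant (fun v => psi' x v - psi x v)).
    - intros v.
      apply continuity_pt_minus;
        apply (continuity_2d_pt_slices _ x v); [apply Hcont'|apply Hcont].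
    - intros v.
      apply Hint. }
  lra.
Qed.

Lemma iter_lifted_map_fst (alpha : R) (psi : R -> R -> R) (n : nat) (p : R * R) :
  fst (Nat.iter n (lifted_map alpha psi) p) = fst p + INR n * alpha.
Proof.
  induction n as [|n IH].
  - simpl.
    ring.
  - rewrite S_INR.
    simpl.
    rewrite IH.
    ring.
Qed.

(** If two lifts differ by [k], periodicity in the angle makes their [n]-th iterates differ by
    [n k], and the averages by [k]. *)
Lemma fibered_rotation_number_mod_Z (alpha : R) (A : R -> mat2) (r r' : R) :
  is_fibered_rotation_number alpha A r -> is_fibered_rotation_number alpha A r' ->
  exists k : Z, r' = r + IZR k.
Proof.
  intros [psi [Hpsi Hr]] [psi' [Hpsi' Hr']].
  destruct (cocycle_lift_unique A psi psi' Hpsi Hpsi') as [k Hk].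
  exists k.
  assert (Hiter : forall n,
    snd (Nat.iter n (lifted_map alpha psi') (0, 0)) =
    snd (Nat.iter n (lifted_map alpha psi) (0, 0)) + INR n * IZR k).
  { induction n as [|n IH].
    - simpl.
      ring.
    - rewrite S_INR.
      simpl.
      rewrite IH, Hk, !iter_lifted_map_fst.
      rewrite INR_IZR_INZ, <- mult_IZR.
      rewrite (periodic_IZR (fun v => psi (fst (0, 0) + IZR (Z.of_nat n) * alpha) v))
        by (intros v; apply Hpsi).
      rewrite mult_IZR.
      ring. }
  specialize (Hr 0 0).
  specialize (Hr' 0 0).
  apply is_lim_seq_unique in Hr'.
  assert (Hlim : is_lim_seq (fun n : nat =>
    (snd (Nat.iter n (lifted_map alpha psi') (0, 0)) - 0) / INR n) (r + IZR k)).
  { apply is_lim_seq_ext_loc with (fun n : nat =>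
      (snd (Nat.iter n (lifted_map alpha psi) (0, 0)) - 0) / INR n + IZR k).
    - exists 1%nat.
      intros n Hn.
      rewrite Hiter.
      field.
      apply not_0_INR.
      lia.
    - apply is_lim_seq_plus'; [assumption|apply is_lim_seq_const]. }
  apply is_lim_seq_unique in Hlim.
  rewrite Hlim in Hr'.
  injection Hr'.
  auto.
Qed.

Lemma iter_lifted_map_increasing (alpha : R) (A : R -> mat2) (psi : R -> R -> R)
  (n : nat) (x y z : R) :
  cocycle_lift A psi ->
  (forall x, 0 < m11 (A x) * m22 (A x) - m12 (A x) * m21 (A x)) -> y <= z ->
  snd (Nat.iter n (lifted_map alpha psi) (x, y)) <=
  snd (Nat.iter n (lifted_map alpha psi) (x, z)).
Proof.
  intros Hpsi Hdet Hyz.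
  induction n as [|n IH]; [assumption|].
  simpl.
  rewrite !iter_lifted_map_fst.
  now apply (cocycle_lift_increasing A).
Qed.

(** The common sign [e] cancels in the products below, so the parity of [p] need not be tracked. *)
Lemma cos_sin_half_turns (p : Z) :
  exists e : R, e * e = 1 /\ forall z : R,
    cos (2 * PI * (IZR p / 2 + z)) = e * cos (2 * PI * z) /\
    sin (2 * PI * (IZR p / 2 + z)) = e * sin (2 * PI * z).
Proof.
  assert (H0 : sin (IZR p * PI) = 0) by (apply sin_eq_0_1; now exists p).
  exists (cos (IZR p * PI)).
  split.
  - pose proof (sin2_cos2 (IZR p * PI)) as H.
    unfold Rsqr in H.
    rewrite H0 in H.
    lra.
  - intros z.
    replace (2 * PI * (IZR p / 2 + z)) with (IZR p * PI + 2 * PI * z) by field.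
    rewrite cos_plus, sin_plus, H0.
    split; ring.
Qed.

(** The orbit of the integer angle [j] carries the vectors [(U (n+1), U n)], starting from [(1, 0)].
    The signs of consecutive values place each direction within a quarter turn of [j + n a / 2]:
    [a = 1] when the signs alternate, [a = 0] when they agree. *)
Lemma dirichlet_orbit_angle (alpha : R) (c : R -> R) (x sigma : R) (a j : Z) (U : nat -> R) :
  (sigma = 1 /\ a = 1%Z \/ sigma = -1 /\ a = 0%Z) ->
  U 0%nat = 0 -> U 1%nat = 1 ->
  (forall i, U (S (S i)) = c (x + INR i * alpha) * U (S i) - U i) ->
  (forall n, sigma * (U (S (S n)) * U (S n)) < 0) ->
  forall n, Rabs (snd (Nat.iter n
      (lifted_map alpha (fun x y => schrodinger_psi (c x) y)) (x, IZR j))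
    - IZR j - INR n * (IZR a / 2)) <= 1 / 4.
Proof.
  intros Hsig HU0 HU1 HU Hsign.
  pose proof PI_RGT_0 as Hpi.
  set (T := lifted_map alpha (fun x y => schrodinger_psi (c x) y)).
  assert (Hinv : forall n, exists r z : R, 0 < r /\
    snd (Nat.iter n T (x, IZR j)) = IZR (2 * j + a * Z.of_nat n) / 2 + z /\
    - (1 / 4) < z < 1 / 4 /\
    U (S n) = r * cos (2 * PI * snd (Nat.iter n T (x, IZR j))) /\
    U n = r * sin (2 * PI * snd (Nat.iter n T (x, IZR j)))).
  { induction n as [|n (r & z & Hr & Hy & Hz & HUS & HUn)].
    - exists 1, 0.
      pose proof (periodic_IZR _ 0 j cos_2PI_periodic) as Hcos.
      pose proof (periodic_IZR _ 0 j sin_2PI_periodic) as Hsin.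
      cbv beta in Hcos, Hsin.
      rewrite Rplus_0_l, Rmult_0_r in Hcos, Hsin.
      rewrite cos_0 in Hcos.
      rewrite sin_0 in Hsin.
      change (snd (Nat.iter 0 T (x, IZR j))) with (IZR j).
      change (Z.of_nat 0) with 0%Z.
      rewrite Hcos, Hsin, Z.mul_0_r, Z.add_0_r, mult_IZR.
      repeat split; lra.
    - set (y := snd (Nat.iter n T (x, IZR j))) in *.
      assert (Hy' : snd (Nat.iter (S n) T (x, IZR j)) =
        y + schrodinger_psi (c (x + INR n * alpha)) y).
      { change (y + schrodinger_psi (c (fst (Nat.iter n T (x, IZR j)))) y =
          y + schrodinger_psi (c (x + INR n * alpha)) y).
        unfold T.
        now rewrite iter_lifted_map_fst. }
      rewrite Hy'.
      set (cn := c (x + INR n * alpha)) in *.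
      destruct (schrodinger_psi_bound cn y) as [Hb1 Hb2].
      destruct (schrodinger_psi_direction cn y) as [r' (Hr' & Hd1 & Hd2)].
      set (y' := y + schrodinger_psi cn y) in *.
      assert (HUS' : U (S n) = r * r' * sin (2 * PI * y'))
        by (rewrite HUS, Hd2; ring).
      assert (HUSS : U (S (S n)) = r * r' * cos (2 * PI * y')).
      { rewrite HU.
        fold cn.
        rewrite HUS, HUn.
        replace (cn * (r * cos (2 * PI * y)) - r * sin (2 * PI * y))
          with (r * (cn * cos (2 * PI * y) - sin (2 * PI * y))) by ring.
        rewrite Hd1.
        ring. }
      assert (Hrr : 0 < r * r') by now apply Rmult_lt_0_compat.
      destruct (cos_sin_half_turns (2 * j + a * Z.of_nat n)) as [e [He Hcs]].
      set (q := IZR (2 * j + a * Z.of_nat n) / 2) in *.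
      set (z' := y' - q).
      (* The a priori window of the lift; the two sign conditions that follow cut it down to a
         quarter turn. *)
      assert (Hz' : - (1 / 2) < z' < 1) by (unfold z', y'; lra).
      assert (Hcosz : 0 < cos (2 * PI * z)) by (apply cos_gt_0; nra).
      (* The second coordinate of the image is the first coordinate of the old vector, whose cosine
         has sign [e]. *)
      assert (Hsinz' : 0 < sin (2 * PI * z')).
      { rewrite Hy, (proj1 (Hcs z)) in Hd2.
        replace y' with (q + z') in Hd2 by (unfold z'; ring).
        rewrite (proj2 (Hcs z')) in Hd2.
        apply Rmult_lt_reg_l with r'; [assumption|].
        rewrite Rmult_0_r.
        replace (r' * sin (2 * PI * z')) with (e * e * (r' * sin (2 * PI * z')))
          by (rewrite He; ring).
        replace (e * e * (r' * sin (2 * PI * z')))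
          with (e * (r' * (e * sin (2 * PI * z')))) by ring.
        rewrite <- Hd2, <- Rmult_assoc, He.
        lra. }
      assert (Hhalf : 0 < z' < 1 / 2).
      { split.
        - destruct (Rlt_le_dec 0 z') as [H|H]; [assumption|].
          exfalso.
          assert (sin (2 * PI * - z') >= 0) by (apply Rle_ge, sin_ge_0; nra).
          rewrite <- Ropp_mult_distr_r, sin_neg in *.
          lra.
        - destruct (Rlt_le_dec z' (1 / 2)) as [H|H]; [assumption|].
          exfalso.
          assert (sin (2 * PI * z') <= 0) by (apply sin_le_0; nra).
          lra. }
      assert (Hcosz' : sigma * cos (2 * PI * z') < 0).
      { pose proof (Hsign n) as Hs.
        rewrite HUSS, HUS' in Hs.
        replace y' with (q + z') in Hs by (unfold z'; ring).
        rewrite (proj1 (Hcs z')), (proj2 (Hcs z')) in Hs.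
        destruct (Rlt_le_dec (sigma * cos (2 * PI * z')) 0) as [H|H]; [assumption|].
        exfalso.
        assert (0 <= (r * r') * (r * r') * (e * e) *
          (sigma * cos (2 * PI * z') * sin (2 * PI * z'))).
        { rewrite He.
          apply Rmult_le_pos; [nra|].
          apply Rmult_le_pos; lra. }
        lra. }
      exists (r * r'), (y' - IZR (2 * j + a * Z.of_nat (S n)) / 2).
      split; [assumption|].
      split; [ring|].
      split; [|now split].
      replace (IZR (2 * j + a * Z.of_nat (S n)) / 2) with (q + IZR a / 2).
      2:{ unfold q.
          rewrite Nat2Z.inj_succ, <- Z.add_1_r, !plus_IZR, !mult_IZR, plus_IZR.
          field. }
      replace (y' - (q + IZR a / 2)) with (z' - IZR a / 2) by (unfold z'; ring).
      (* A negative cosine leaves [z'] in (1/4, 1/2) and a half turn is subtracted; a positive one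
         leaves it in (0, 1/4). *)
      destruct Hsig as [[-> ->]|[-> ->]].
      + destruct (Rlt_le_dec (1 / 4) z') as [H|H]; [lra|].
        exfalso.
        assert (0 <= cos (2 * PI * z')) by (apply cos_ge_0; nra).
        lra.
      + destruct (Rlt_le_dec z' (1 / 4)) as [H|H]; [lra|].
        exfalso.
        assert (cos (2 * PI * z') <= 0) by (apply cos_le_0; nra).
        lra. }
  intros n.
  destruct (Hinv n) as (r & z & _ & Hy & Hz & _).
  rewrite Hy, plus_IZR, !mult_IZR, <- INR_IZR_INZ.
  replace (_ - INR n * (IZR a / 2)) with z by field.
  apply Rabs_le.
  lra.
Qed.

(** * The rotation number outside the spectrum *)

(* Testing the form on the solution cut off to [1, n]: only the site n contributes. *)
Lemma dirichlet_solution_signs (V : Z -> R) (E sigma : R) (U : nat -> R) :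
  U 0%nat = 0 -> U 1%nat = 1 ->
  (forall i, U (S (S i)) = (E - V (Z.of_nat (S i))) * U (S i) - U i) ->
  (forall u, finitely_supported u -> 0 < dotZ u u ->
     0 < sigma * (dotZ (jacobi V u) u - E * dotZ u u)) ->
  forall n, sigma * (U (S (S n)) * U (S n)) < 0.
Proof.
  intros HU0 HU1 HU Hpos n.
  set (w := fun k : Z =>
    if Z_lt_le_dec k 1 then 0
    else if Z_lt_le_dec (Z.of_nat (S n)) k then 0 else U (Z.to_nat k)).
  assert (Hin : forall i, (i <= S n)%nat -> w (Z.of_nat i) = U i).
  { intros i Hi.
    unfold w.
    destruct Z_lt_le_dec as [H|H].
    - replace i with 0%nat by lia.
      now rewrite HU0.
    - destruct Z_lt_le_dec; [lia|].
      now rewrite Nat2Z.id. }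
  assert (Hout : forall k, (k < 1 \/ Z.of_nat (S n) < k)%Z -> w k = 0).
  { intros k Hk.
    unfold w.
    destruct Z_lt_le_dec; [reflexivity|].
    destruct Z_lt_le_dec; [reflexivity|lia]. }
  assert (Hw : finitely_supported w).
  { exists (S n).
    intros k Hk.
    apply Hout.
    lia. }
  specialize (Hpos w Hw).
  (* The cut at 0 is harmless because [U 0 = 0]. At site [n + 1] the lost neighbour leaves
     [- U (n+2)] as the value of [(H - E) w], and outside the support the factor [w] vanishes. *)
  replace (dotZ (jacobi V w) w - E * dotZ w w) with (- (U (S (S n)) * U (S n))) in Hpos.
  - enough (0 < sigma * - (U (S (S n)) * U (S n))) by lra.
    apply Hpos.
    apply (dotZ_gt0 _ 1 Hw).
    rewrite Hin, HU1 by lia.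
    lra.
  - assert (Hjw : finitely_supported (jacobi V w))
      by now apply finitely_supported_jacobi.
    transitivity (dotZ (fun k => jacobi V w k + - E * w k) w).
    2:{ rewrite dotZ_plus_l, dotZ_scal_l;
          [ring|assumption|now apply finitely_supported_mult_r]. }
    unfold dotZ.
    rewrite (sumZ_single _ (S n)).
    + unfold jacobi.
      replace (Z.of_nat (S n) - 1)%Z with (Z.of_nat n) by lia.
      rewrite (Hout (Z.of_nat (S n) + 1)%Z) by lia.
      rewrite !Hin, HU by lia.
      ring.
    + intros k Hk.
      destruct (classic (k < 1 \/ Z.of_nat (S n) < k)%Z) as [H|H].
      * rewrite (Hout k H).
        ring.
      * assert (Hi : exists i : nat, k = Z.of_nat (S i) /\ (S i < S n)%nat).
        { exists (Z.to_nat (k - 1)).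
          lia. }
        destruct Hi as [i [-> Hi]].
        unfold jacobi.
        replace (Z.of_nat (S i) - 1)%Z with (Z.of_nat i) by lia.
        replace (Z.of_nat (S i) + 1)%Z with (Z.of_nat (S (S i))) by lia.
        rewrite !Hin, HU by lia.
        ring.
Qed.

(** Carrying [(U (n+1), U n)] makes the second-order recursion structural, so the recursion for [U]
    holds by computation. *)
Fixpoint solution_pair (c : nat -> R) (n : nat) : R * R :=
  match n with
  | O => (1, 0)
  | S i => (c i * fst (solution_pair c i) - snd (solution_pair c i),
            fst (solution_pair c i))
  end.

Lemma bounded_deviation_limit (v : nat -> R) (l D : R) :
  (forall n, Rabs (v n - INR n * l) <= D) -> is_lim_seq (fun n => v n / INR n) l.
Proof.
  intros H.
  assert (Hinv : is_lim_seq (fun n => / INR n) 0).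
  { replace (Finite 0) with (Rbar_inv p_infty) by reflexivity.
    apply is_lim_seq_inv; [apply is_lim_seq_INR|discriminate]. }
  apply is_lim_seq_le_le_loc with (fun n => l + - D * / INR n) (fun n => l + D * / INR n).
  - exists 1%nat.
    intros n Hn.
    assert (Hn0 : 0 < INR n) by (apply lt_0_INR; lia).
    specialize (H n).
    apply Rabs_le_between in H.
    pose proof (Rinv_0_lt_compat _ Hn0) as Hi.
    replace (v n / INR n) with (l + (v n - INR n * l) * / INR n) by (field; lra).
    split; apply Rplus_le_compat_l; apply Rmult_le_compat_r; lra.
  - replace (Finite l) with (Finite (l + - D * 0)) by (f_equal; ring).
    apply is_lim_seq_plus'; [apply is_lim_seq_const|].
    apply is_lim_seq_mult'; [apply is_lim_seq_const|assumption].
  - replace (Finite l) with (Finite (l + D * 0)) by (f_equal; ring).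
    apply is_lim_seq_plus'; [apply is_lim_seq_const|].
    apply is_lim_seq_mult'; [apply is_lim_seq_const|assumption].
Qed.

(** Integer initial angles follow the Dirichlet solution; any other orbit stays between those of the
    two neighbouring integers by monotonicity. *)
Lemma rotation_number_definite_form (lambda : R) (f : R -> R) (alpha E sigma : R) (a : Z) :
  (forall x, f (x + 1) = f x) -> (forall x, continuity_pt f x) ->
  (sigma = 1 /\ a = 1%Z \/ sigma = -1 /\ a = 0%Z) ->
  (forall theta u, finitely_supported u -> 0 < dotZ u u ->
     0 < sigma * (dotZ (jacobi (fun k => lambda * f (theta + IZR k * alpha)) u) u
                  - E * dotZ u u)) ->
  is_fibered_rotation_number alpha (S_cocycle lambda f E) (IZR a / 2).
Proof.
  intros Hper Hcont Hsig Hform.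
  set (c := fun x => E - lambda * f x).
  assert (Hlift : cocycle_lift (S_cocycle lambda f E)
                    (fun x y => schrodinger_psi (c x) y)).
  { apply (schrodinger_psi_lift c).
    - intros x.
      unfold c.
      now rewrite Hper.
    - intros x.
      apply continuity_pt_minus.
      + apply continuity_pt_const.
        now intros ? ?.
      + now apply continuity_pt_scal. }
  exists (fun x y => schrodinger_psi (c x) y).
  split; [assumption|].
  intros x y.
  set (U := fun n => snd (solution_pair (fun i => c (x + INR i * alpha)) n)).
  assert (HU : forall i, U (S (S i)) = c (x + INR i * alpha) * U (S i) - U i)
    by reflexivity.
  assert (Hsign : forall n, sigma * (U (S (S n)) * U (S n)) < 0).
  (* The phase [x - alpha] puts the base point [x] at site 1, where the recursion for [U] starts. *)
  { apply (dirichlet_solution_signs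
             (fun k => lambda * f (x - alpha + IZR k * alpha)) E sigma U);
      [reflexivity|reflexivity| |apply Hform].
    intros i.
    rewrite HU.
    unfold c.
    replace (x - alpha + IZR (Z.of_nat (S i)) * alpha) with (x + INR i * alpha)
      by (rewrite <- INR_IZR_INZ, S_INR; ring).
    reflexivity. }
  pose proof (fun j => dirichlet_orbit_angle alpha c x sigma a j U Hsig
                         eq_refl eq_refl HU Hsign) as Hbound.
  (* The deviation 1/4 of the integer orbits plus at most 1 between [y] and those integers. *)
  apply bounded_deviation_limit with (5 / 4).
  intros n.
  destruct (archimed y) as [H1 H2].
  pose proof (Hbound (up y - 1)%Z n) as Hlow.
  pose proof (Hbound (up y) n) as Hup.
  assert (Hdet : forall x, 0 < m11 (S_cocycle lambda f E x) * m22 (S_cocycle lambda f E x)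
                          - m12 (S_cocycle lambda f E x) * m21 (S_cocycle lambda f E x)).
  { intros x'.
    simpl.
    lra. }
  pose proof (iter_lifted_map_increasing alpha _ _ n x (IZR (up y - 1)) y Hlift Hdet
                ltac:(rewrite minus_IZR; lra)) as Hm1.
  pose proof (iter_lifted_map_increasing alpha _ _ n x y (IZR (up y)) Hlift Hdet
                ltac:(lra)) as Hm2.
  apply Rabs_le_between in Hlow, Hup.
  rewrite minus_IZR in *.
  apply Rabs_le.
  lra.
Qed.

(** To evaluate [iota], uniqueness is needed: rotation numbers differ by integers, and two points of
    [0, 1/2] can only differ by the integer 0. *)
Lemma rho_definite_form (lambda : R) (f : R -> R) (alpha E sigma : R) (a : Z) :
  (forall x, f (x + 1) = f x) -> (forall x, continuity_pt f x) ->
  (sigma = 1 /\ a = 1%Z \/ sigma = -1 /\ a = 0%Z) ->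
  (forall theta u, finitely_supported u -> 0 < dotZ u u ->
     0 < sigma * (dotZ (jacobi (fun k => lambda * f (theta + IZR k * alpha)) u) u
                  - E * dotZ u u)) ->
  rho lambda f alpha E = IZR a / 2.
Proof.
  intros Hper Hcont Hsig Hform.
  pose proof (rotation_number_definite_form lambda f alpha E sigma a
                Hper Hcont Hsig Hform) as Hrot.
  apply (iota_unique (V := R_CompleteNormedModule)).
  - intros r [Hr Hrot'].
    destruct (fibered_rotation_number_mod_Z _ _ _ _ Hrot Hrot') as [k ->].
    assert (Hk : (-1 < k < 1)%Z).
    { destruct Hsig as [[_ ->]|[_ ->]]; split; apply lt_IZR; lra. }
    replace k with 0%Z by lia.
    apply Rplus_0_r.
  - split; [|assumption].
    destruct Hsig as [[_ ->]|[_ ->]]; lra.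
Qed.

(** [sigma = 1] treats energies below the spectrum and [sigma = -1] those above it. The extremal
    form value for each [theta] lies in the spectrum, hence on the far side of [E]. *)
Lemma form_definite_outside_spectrum (lambda : R) (f : R -> R) (alpha E sigma : R) :
  (forall x, f (x + 1) = f x) -> (forall x, continuity_pt f x) ->
  sigma * sigma = 1 ->
  (forall m, Sigma lambda f alpha (sigma * m) -> sigma * E < m) ->
  forall theta u, finitely_supported u -> 0 < dotZ u u ->
     0 < sigma * (dotZ (jacobi (fun k => lambda * f (theta + IZR k * alpha)) u) u
                  - E * dotZ u u).
Proof.
  intros Hper Hcont Hsig Hout theta u Hu Hpos.
  destruct (continuous_periodic_bounded f Hper Hcont) as [M HM].
  destruct (form_extremum_in_spectrum (schrodinger lambda f alpha theta)
    (fun k => lambda * f (theta + IZR k * alpha)) (Rabs lambda * M) sigma)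
    as [m [Hspec Hm]].
  - reflexivity.
  - intros k.
    rewrite Rabs_mult.
    apply Rmult_le_compat_l; [apply Rabs_pos|apply HM].
  - assumption.
  - specialize (Hm u Hu).
    assert (HE : sigma * E < m) by (apply Hout; now exists theta).
    nra.
Qed.

(** This lets [gap0] be handled as a gap with label 0. *)
Lemma rho_gap0 (lambda : R) (f : R -> R) (alpha E : R) :
  real_analytic_circle f -> gap0 lambda f alpha E ->
  exists k : Z, 2 * rho lambda f alpha E = IZR k.
Proof.
  intros [Hper Han] Hgap.
  assert (Hcont : forall x, continuity_pt f x)
    by (intros x; now apply analytic_at_continuity_pt).
  destruct Hgap as [Hlow|Hhigh].
  - exists 1%Z.
    rewrite (rho_definite_form lambda f alpha E 1 1); auto; [field|].
    apply form_definite_outside_spectrum; auto; [lra|].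
    intros m Hm.
    rewrite Rmult_1_l in *.
    change (Rbar_lt E m).
    eapply Rbar_lt_le_trans; [exact Hlow|].
    now apply (proj1 (Glb_Rbar_correct _)).
  - exists 0%Z.
    rewrite (rho_definite_form lambda f alpha E (-1) 0); auto; [field|].
    apply form_definite_outside_spectrum; auto; [lra|].
    intros m Hm.
    enough (-1 * m < E) by lra.
    change (Rbar_lt (-1 * m) E).
    eapply Rbar_le_lt_trans; [|exact Hhigh].
    now apply (proj1 (Lub_Rbar_correct _)).
Qed.

(** * Distances between gaps *)

Lemma dist_sets_ge (A B : R -> Prop) (c : R) :
  (forall x x' : R, A x -> B x' -> c <= Rabs (x - x')) ->
  Rbar_le c (dist_sets A B).
Proof.
  intros H.
  apply (proj2 (Glb_Rbar_correct _)).
  intros d [x [x' [Hx [Hx' ->]]]].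
  now apply H.
Qed.

Lemma gap_has_label (lambda : R) (f : R -> R) (alpha : R) (Em Ep : Z -> R)
  (m : Z) (E : R) :
  gap_endpoints lambda f alpha Em Ep -> m <> 0%Z -> gap (Em m) (Ep m) E ->
  has_label lambda f alpha m E.
Proof.
  intros Hend Hm Hgap.
  apply (Hend m Hm).
  destruct Hgap; lra.
Qed.

(** Here [k] is the difference of the labels. The small divisor bound and the Hoelder bound give
    [c exp (- 4 b N) <= 2 C sqrt |E1 - E2|]; squaring produces both the constant and the exponent
    8. *)
Lemma energies_separated (alpha c C b : R) (rho0 : R -> R) (E1 E2 : R) (k l : Z) (N : R) :
  0 < c -> 0 < C -> 0 <= b ->
  (forall (k l : Z), k <> 0%Z ->
      c * exp (- 2 * b * IZR (Z.abs k)) <= Rabs (IZR k * alpha - IZR l)) ->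
  Rabs (rho0 E1 - rho0 E2) <= C * sqrt (Rabs (E1 - E2)) ->
  k <> 0%Z -> IZR (Z.abs k) <= 2 * N ->
  2 * rho0 E1 - 2 * rho0 E2 = IZR k * alpha - IZR l ->
  (c / (2 * C)) ^ 2 * exp (- 8 * b * N) <= Rabs (E1 - E2).
Proof.
  intros Hc HC Hb Hdio Hhol Hk HN Hrho.
  specialize (Hdio k l Hk).
  rewrite <- Hrho, <- Rmult_minus_distr_l, Rabs_mult, (Rabs_pos_eq 2) in Hdio by lra.
  assert (Hexp : exp (- 4 * b * N) <= exp (- 2 * b * IZR (Z.abs k)))
    by (apply exp_le_compat; nra).
  pose proof (exp_pos (- 4 * b * N)) as He.
  set (e := exp (- 4 * b * N)) in *.
  replace (exp (- 8 * b * N)) with (e ^ 2).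
  2:{ unfold e.
      simpl.
      rewrite Rmult_1_r, <- exp_plus.
      f_equal.
      ring. }
  rewrite <- (sqrt_sqrt (Rabs (E1 - E2))) by apply Rabs_pos.
  set (s := sqrt (Rabs (E1 - E2))) in *.
  assert (Hs : c / (2 * C) * e <= s).
  { apply Rmult_le_reg_l with (2 * C); [lra|].
    replace (2 * C * (c / (2 * C) * e)) with (c * e) by (field; lra).
    nra. }
  assert (0 < c / (2 * C)) by (apply Rdiv_lt_0_compat; lra).
  rewrite <- Rpow_mult_distr.
  simpl.
  rewrite Rmult_1_r.
  apply Rmult_le_compat; nra.
Qed.

Theorem lemma5p3 (C1 C2 : R) (lambda0 : (R -> R) -> R -> R -> R)
  (HLY : liu_yuan_constants C1 C2 lambda0)
  (lambda : R) (f : R -> R) (alpha : R) :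
  exists cstar : R, 0 < cstar /\
    forall (eta : R),
      admissible C1 C2 f eta alpha ->
      0 < Rabs lambda <= lambda0 f eta alpha ->
      forall Em Ep : Z -> R,
        gap_endpoints lambda f alpha Em Ep ->
        (forall m m' : Z, m <> 0%Z -> m' <> 0%Z -> m' <> m -> (Z.abs m <= Z.abs m')%Z ->
           Rbar_le (cstar * exp (- 8 * real (beta alpha) * IZR (Z.abs m')))
                   (dist_sets (gap (Em m) (Ep m)) (gap (Em m') (Ep m')))) /\
        (forall m : Z, m <> 0%Z ->
           Rbar_le (cstar * exp (- 8 * real (beta alpha) * IZR (Z.abs m)))
                   (dist_sets (gap (Em m) (Ep m)) (gap0 lambda f alpha))).
Proof.
  destruct HLY as (_ & _ & _ & Hhol).
  destruct (Hhol lambda f alpha) as [Cstar HCstar].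
  (* The constant must be chosen before [eta], whereas these conditions on [alpha] come with
     admissibility. If they fail, no [eta] is admissible and any positive constant will do. *)
  destruct (classic (irrational alpha /\
    Rbar_lt 0 (beta alpha) /\ Rbar_lt (beta alpha) p_infty)) as [Halpha|Hno].
  2:{ exists 1.
      split; [lra|].
      intros eta Hadm.
      exfalso.
      apply Hno.
      unfold admissible in Hadm.
      tauto. }
  destruct Halpha as (Hirr & Hpos & Hfin).
  destruct (diophantine_bound alpha Hirr Hpos Hfin) as [c [Hc Hdio]].
  pose proof (Rmax_l Cstar 1) as HC1.
  pose proof (Rmax_r Cstar 1) as HC2.
  (* The maximum with 1 provides a positive Hoelder constant to divide by. *)
  set (C := Rmax Cstar 1) in *.
  exists ((c / (2 * C)) ^ 2).
  split.
  { apply pow_lt.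
    apply Rdiv_lt_0_compat; lra. }
  intros eta Hadm Hlam Em Ep Hend.
  assert (Hb : 0 <= real (beta alpha))
    by (destruct (beta alpha); simpl in *; lra).
  assert (Hrho : forall E1 E2 : R,
    Rabs (rho lambda f alpha E1 - rho lambda f alpha E2) <= C * sqrt (Rabs (E1 - E2))).
  { intros E1 E2.
    eapply Rle_trans; [now apply (HCstar eta)|].
    apply Rmult_le_compat_r; [apply sqrt_pos|assumption]. }
  split.
  - intros m m' Hm Hm' Hne Habs.
    apply dist_sets_ge.
    intros x x' Hx Hx'.
    destruct (gap_has_label _ _ _ _ _ _ _ Hend Hm Hx) as [k Hk].
    destruct (gap_has_label _ _ _ _ _ _ _ Hend Hm' Hx') as [k' Hk'].
    (* The label difference satisfies [|m - m'| <= 2 |m'|] because [|m| <= |m'|]. *)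
    apply (energies_separated alpha c C _ (rho lambda f alpha) x x' (m - m') (k' - k));
      auto; try lra; try lia.
    + rewrite <- mult_IZR.
      apply IZR_le.
      lia.
    + rewrite Hk, Hk', !minus_IZR.
      ring.
  - intros m Hm.
    apply dist_sets_ge.
    intros x x' Hx Hx'.
    destruct (gap_has_label _ _ _ _ _ _ _ Hend Hm Hx) as [k Hk].
    destruct (rho_gap0 lambda f alpha x') as [k' Hk'];
      [apply Hadm|assumption|].
    (* With label 0 on the other side the difference is [m] itself, well within [2 |m|]. *)
    apply (energies_separated alpha c C _ (rho lambda f alpha) x x' m (k' - k));
      auto; try lra.
    + rewrite <- mult_IZR.
      apply IZR_le.
      lia.
    + rewrite Hk, Hk', minus_IZR.
      ring.
Qed.
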